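(* Let $\mathcal{G}$ be an additive arithmetic semigroup of Axiom $\mathcal{A}^\#$ type admitting a classical type of Prime Number Theorem. Let $(X,\mu,T)$ be uniquely ergodic, and let $F\in C_c(\mathbb{R})$. Then $$\lim_{n\to\infty}\frac1{|\mathcal{G}_n|}\sum_{ g\in\mathcal{G}_n}F\Big(\frac{\Omega(g)-\log n}{\sqrt{\log n}}\Big)f(T^{\Omega(g)}x)=\Big(\frac1{\sqrt{2\pi}}\int_{-\infty}^\infty F(t)e^{-t^2/2}dt\Big)\Big(\int_Xf\,d\mu\Big)$$ for every $x\in X$ and $f\in C(X)$. In particular, $$\lim_{n\to\infty}\frac1{|\mathcal{G}_n|}\sum_{ g\in\mathcal{G}_n}f(T^{\Omega(g)}x)=\int_Xf\,d\mu$$ for every $x\in X$ and $f\in C(X)$.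
   Context: An additive arithmetical semigroup is a free Abelian semigroup $\mathcal{G}$ with identity $1$, generated by a countable set $\mathcal{P}$ of primes (every non-identity element factors uniquely into a finite product of powers of elements of $\mathcal{P}$), together with a degree map $\partial:\mathcal{G}\to\mathbb{N}\cup\{0\}$ such that $\partial(1)=0$, $\partial(p)>0$ for $p\in\mathcal{P}$, $\partial(gh)=\partial(g)+\partial(h)$, and $\{g:\partial(g)\le x\}$ is finite for each $x>0$. Let $G(n)$ be the number of elements of degree $n$. $\mathcal{G}$ is of Axiom $\mathcal{A}^\#$ type if there are constants $c>0$, $q>1$, $0\le\eta<1$ with $G(n)=cq^n+O(q^{\eta n})$. Let $\bar{\Lambda}(n)=\sum_{p\in\mathcal{P},r\ge1,\partial(p^r)=n}\partial(p)$; $\mathcal{G}$ admits a classical type of Prime Number Theorem if $\bar{\Lambda}(n)=q^n+O(q^{\theta n})$ for some $\eta<\theta<1$. For $g\in\mathcal{G}$, $\Omega(g)$ is the total number of prime factors of $g$ counted with multiplicity, and $\mathcal{G}_n$ is the (finite) set of elements of $\mathcal{G}$ of degree at most $n$. $(X,\mu,T)$ uniquely ergodic means $X$ is a compact metric space, $T:X\to X$ continuous, and $\mu$ is the unique $T$-invariant Borel probability measure. *)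

(* Defs.v *)
From HB Require Import structures.
From mathcomp Require Import all_boot all_order all_algebra all_fingroup.
From mathcomp Require Import finmap.
From mathcomp Require Import complex.
From mathcomp Require Import all_classical all_reals all_analysis.

Set Implicit Arguments.
Unset Strict Implicit.
Unset Printing Implicit Defensive.

Import Order.TTheory GRing.Theory Num.Theory.
Import numFieldNormedType.Exports.

Local Open Scope classical_set_scope.
Local Open Scope ring_scope.

(* The factorization of an element is a sequence of primes, taken up to
   permutation; the empty sequence factors the identity. *)
Record arithSemigroup (G : monoidType) := ArithSemigroup {
  mulgC : commutative (@mul G) ;
  prime_elts : set G ;
  prime_elts_countable : countable prime_elts ;
  factorization : forall g : G, exists2 s : seq G,
    {in s, forall p, prime_elts p} & g = (\prod_(p <- s) p)%g ;
  factorization_uniq : forall s t : seq G,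
    {in s, forall p, prime_elts p} -> {in t, forall p, prime_elts p} ->
    (\prod_(p <- s) p)%g = (\prod_(p <- t) p)%g -> perm_eq s t ;
  deg : G -> nat ;
  deg1 : deg 1%g = 0%N ;
  deg_gt0 : forall p, prime_elts p -> (0 < deg p)%N ;
  degM : forall g h : G, deg (g * h)%g = (deg g + deg h)%N ;
  deg_finite : forall n : nat, finite_set [set g | (deg g <= n)%N]
}.

Section ArithSemigroupTheory.
Variables (G : monoidType) (S : arithSemigroup G).

Definition Omega (g : G) : nat := size (s2val (cid2 (factorization S g))).

Lemma Omega_prod (s : seq G) : {in s, forall p, prime_elts S p} ->
  Omega (\prod_(p <- s) p)%g = size s.
Proof.
move=> sP; rewrite /Omega; case: cid2 => t tP /= st.
by apply/perm_size; apply: (factorization_uniq tP sP).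
Qed.

Definition count_deg (n : nat) : nat :=
  #|` fset_set [set g | deg S g = n]|%N.

Definition elts_le (n : nat) : set G := [set g | (deg S g <= n)%N].

Definition Lambda_bar (n : nat) : nat :=
  (\sum_(pr \in [set pr : G * nat |
     [/\ prime_elts S pr.1, (1 <= pr.2)%N & deg S (pr.1 ^+ pr.2)%g = n]])
     deg S pr.1)%N.

Variable R : realType.

Definition axiom_Asharp (c q eta : R) :=
  [/\ 0 < c, 1 < q, 0 <= eta < 1 &
    (fun n : nat => (count_deg n)%:R - c * q ^+ n) =O_\oo
    (fun n : nat => q `^ (eta * n%:R))].

Definition classical_PNT (q eta : R) :=
  exists2 theta : R, eta < theta < 1 &
    (fun n : nat => (Lambda_bar n)%:R - q ^+ n) =O_\oo
    (fun n : nat => q `^ (theta * n%:R)).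

End ArithSemigroupTheory.

(* The generated sigma-algebra below is only defined on pointed types; a space
   carrying a probability measure is nonempty anyway. *)
#[short(type="pmetricType")]
HB.structure Definition PMetric (K : numDomainType) :=
  {X of Pointed X & Metric K X}.

Notation borel X := (g_sigma_algebraType (@open X)).

Definition invariant_measure (R : realType) (X : pmetricType R)
    (mu : probability (borel X) R) (T : X -> X) :=
  forall A : set (borel X), measurable A -> mu (T @^-1` A) = mu A.

Definition uniquely_ergodic (R : realType) (X : pmetricType R)
    (mu : probability (borel X) R) (T : X -> X) :=
  [/\ compact [set: X], continuous T, invariant_measure mu T &
    forall nu : probability (borel X) R, invariant_measure nu T ->
      forall A : set (borel X), measurable A -> nu A = mu A].

(* Complex numbers are used so that continuous functions may be complex-valued;
   integrals are taken on real and imaginary parts. *)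
Definition Cintegral d (X : measurableType d) (R : realType)
    (mu : {measure set X -> \bar R}) (f : X -> R[i]) : R[i] :=
  Complex (\int[mu]_x complex.Re (f x)) (\int[mu]_x complex.Im (f x)).

(* `R[i]^o` carries the topology of the complex modulus. *)
Definition continuous_compact_support (R : realType) (F : R -> R[i]^o) :=
  continuous F /\ compact (closure [set t | F t != 0]).

(* Main.v *)
(* Let [Q_n = prod_(j <= n) (1 + (X - 1) / j)], the generating polynomial of the
   number of cycles of a random permutation, so that [n Q_n = X sum_(m < n) Q_m].
   Writing every element as a product of prime powers gives the generating
   polynomials [P_n] of [Omega] in degree [n] (divided by [q^n]) a recursion
   [n P_n = sum_(m <= n) lam_m P_(n-m)], where the prime number theorem makes
   [sum_m ||lam_m - X||] finite for the l1 norm on coefficients.  Hence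
   [P_n = sum_m h_m Q_(n-m)] with [sum_m ||h_m||] finite, and since neither a
   shift by one nor a bounded change of [n] affects [Q_n] asymptotically, the law
   of [Omega] on [G_n] is asymptotic to [Q_n] in total variation.

   Stein's identity [E(k f(k)) = ln n * E(f(k+1)) + O(sup |f|)] under [Q_n] yields
   both [||(X - 1) Q_n|| -> 0] and the central limit theorem.  Finally, weights on
   the orbit of [x] which are asymptotically invariant under the shift have only
   [T]-invariant limits: a limit along an ultrafilter is a finitely additive
   invariant content [m], the associated outer measure is an invariant
   probability measure [nu] with [nu U <= m U] for open [U], and [nu = mu]. *)
Require Import Defs.
From HB Require Import structures.
From mathcomp Require Import all_boot all_order all_algebra all_fingroup.
From mathcomp Require Import finmap.
From mathcomp Require Import complex.
From mathcomp Require Import ring lra zify.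
From mathcomp Require Import all_classical all_reals all_analysis.
From mathcomp Require Import measurable_realfun.

Set Implicit Arguments.
Unset Strict Implicit.
Unset Printing Implicit Defensive.

Import Order.TTheory GRing.Theory Num.Theory.
Import numFieldNormedType.Exports.

Local Open Scope classical_set_scope.
Local Open Scope ring_scope.

(** * Polynomials as finitely supported signed measures *)

(** The l1 norm on coefficients is submultiplicative, so generating series in a second variable [z]
    are handled as sequences in a normed algebra. The [Q_n] are the coefficients of [(1 - z)^(-X)],
    and [h] is the quotient of the series of the [P_n] by this one, built from the difference of the
    logarithmic derivatives. Summability of [||h_m||] comes from summing [m ||h_m|| <= sum_i ||lam_i
    - X|| ||h_(m-i)||] over [m]: finitely many terms then control all the others. Evaluation at
    [X = 1] identifies [sum_m h_m(1)] with the constant [c > 0] of the axiom, and passing from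
    degree [n] to degree at most [n] is one more convolution, with weights [q^-m].

    The limit is a product because [F] is put into the weights: [F((k - ln n) / sqrt(ln n))] changes
    by [o(1)] when [k] moves by one, so the reweighted law is again asymptotically shift invariant
    and the ergodic argument applies to it. That argument needs non-negative weights, so a constant
    is added to [F] and removed at the end. *)

Section PolyMeasure.
Variable R : realType.
Implicit Types (p r : {poly R}) (f : nat -> R).

Definition pint p f := \sum_(i < size p) p`_i * f i.
Definition norm1 p := \sum_(i < size p) `|p`_i|.

Lemma pint_widen n p f : (size p <= n)%N -> pint p f = \sum_(i < n) p`_i * f i.
Proof.
move=> pn; rewrite /pint (big_ord_widen n (fun i => p`_i * f i)) // big_mkcond.
by apply: eq_bigr => i _; case: ltnP => // /(nth_default 0) ->; rewrite mul0r.
Qed.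

Lemma norm1_widen n p : (size p <= n)%N -> norm1 p = \sum_(i < n) `|p`_i|.
Proof.
move=> pn; rewrite /norm1 (big_ord_widen n (fun i => `|p`_i|)) // big_mkcond.
by apply: eq_bigr => i _; case: ltnP => // /(nth_default 0) ->; rewrite normr0.
Qed.

Lemma pintD p r f : pint (p + r) f = pint p f + pint r f.
Proof.
pose n := maxn (size p) (size r).
rewrite !(@pint_widen n) ?leq_maxl ?leq_maxr ?size_polyD // -big_split /=.
by apply: eq_bigr => i _; rewrite coefD mulrDl.
Qed.

Lemma pintZ a p f : pint (a *: p) f = a * pint p f.
Proof.
rewrite (pint_widen _ (size_scale_leq a p)) mulr_sumr.
by apply: eq_bigr => i _; rewrite coefZ mulrA.
Qed.

Lemma pintN p f : pint (- p) f = - pint p f.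
Proof. by rewrite -scaleN1r pintZ mulN1r. Qed.

Lemma pintB p r f : pint (p - r) f = pint p f - pint r f.
Proof. by rewrite pintD pintN. Qed.

Lemma pintDr p f g : pint p (fun k => f k + g k) = pint p f + pint p g.
Proof. by rewrite -big_split /=; apply: eq_bigr => i _; rewrite mulrDr. Qed.

Lemma pintZr a p f : pint p (fun k => a * f k) = a * pint p f.
Proof. by rewrite mulr_sumr; apply: eq_bigr => i _; rewrite mulrCA. Qed.

Lemma pintNr p f : pint p (fun k => - f k) = - pint p f.
Proof. by rewrite -sumrN; apply: eq_bigr => i _; rewrite mulrN. Qed.

Lemma pintBr p f g : pint p (fun k => f k - g k) = pint p f - pint p g.
Proof. by rewrite -pintNr -pintDr. Qed.

Lemma pint1 p : pint p (fun=> 1) = p.[1].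
Proof.
by rewrite horner_coef; apply: eq_bigr => i _; rewrite expr1n.
Qed.

Lemma pint_cst p a : pint p (fun=> a) = a * p.[1].
Proof.
rewrite -pint1 -pintZr; apply: eq_bigr => i _; by rewrite mulr1.
Qed.

Lemma pintX p f : pint ('X * p) f = pint p (fun k => f k.+1).
Proof.
rewrite (@pint_widen (size p).+1); last first.
  by rewrite (leq_trans (size_polyMleq _ _)) // size_polyX.
rewrite big_ord_recl coefXM /= mul0r add0r.
by apply: eq_bigr => i _; rewrite coefXM.
Qed.

(** With [pintX] this is the dictionary between polynomials and laws: [X] shifts the variable by one
    and [X d/dX] weights by [k], so Stein's identity becomes an estimate on a polynomial. *)
Lemma pint_deriv p f : pint ('X * p^`()) f = pint p (fun k => k%:R * f k).
Proof.
rewrite (@pint_widen (size p).+1); last first.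
  rewrite (leq_trans (size_polyMleq _ _)) // size_polyX /=.
  by rewrite ltnS (leq_trans (size_poly _ _)) ?leq_pred.
rewrite big_ord_recl coefXM /= mul0r add0r.
rewrite (@pint_widen (size p).+1) // big_ord_recl mul0r mulr0 add0r.
apply: eq_bigr => i _; rewrite coefXM /= coef_deriv mulrA.
by rewrite mulr_natr.
Qed.

Lemma pint_poly n (w f : nat -> R) :
  pint (\poly_(i < n) w i) f = \sum_(i < n) w i * f i.
Proof.
rewrite (@pint_widen n) ?size_poly //; apply: eq_bigr => i _.
by rewrite coef_poly ltn_ord.
Qed.

Lemma pint_sum (I : Type) (s : seq I) (P : pred I) (F : I -> {poly R}) f :
  pint (\sum_(i <- s | P i) F i) f = \sum_(i <- s | P i) pint (F i) f.
Proof.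
elim/big_rec2: _ => [|i y1 y2 _ <-]; last by rewrite pintD.
by rewrite /pint size_poly0 big_ord0.
Qed.

Lemma norm1E p : norm1 p = pint p (fun k => Num.sg p`_k).
Proof. by apply: eq_bigr => i _; rewrite mulrC -normrEsg. Qed.

Lemma norm1_ge0 p : 0 <= norm1 p. Proof. exact: sumr_ge0. Qed.

Lemma pint_le p f M : (forall k, `|f k| <= M) -> `|pint p f| <= norm1 p * M.
Proof.
move=> fM; rewrite (le_trans (ler_norm_sum _ _ _)) // mulr_suml ler_sum // => i _.
by rewrite normrM ler_wpM2l.
Qed.

(** The signs of the coefficients form the extremal test function, so total variation can be bounded
    by testing. *)
Lemma norm1_le p M :
  (forall f, (forall k, `|f k| <= 1) -> pint p f <= M) -> norm1 p <= M.
Proof. by move=> H; rewrite norm1E H // => k; rewrite normr_sg lern1 leq_b1. Qed.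

Lemma norm1D p r : norm1 (p + r) <= norm1 p + norm1 r.
Proof.
apply: norm1_le => f fM; rewrite pintD.
by rewrite lerD // (le_trans (ler_norm _)) // (le_trans (pint_le _ fM)) // mulr1.
Qed.

Lemma norm1Z a p : norm1 (a *: p) = `|a| * norm1 p.
Proof.
rewrite (norm1_widen (size_scale_leq a p)) mulr_sumr.
by apply: eq_bigr => i _; rewrite coefZ normrM.
Qed.

Lemma norm1N p : norm1 (- p) = norm1 p.
Proof. by rewrite -scaleN1r norm1Z normrN1 mul1r. Qed.

Lemma norm1B p r : norm1 (p - r) <= norm1 p + norm1 r.
Proof. by rewrite (le_trans (norm1D _ _)) // norm1N. Qed.

Lemma norm1_distC p r : norm1 (p - r) = norm1 (r - p).
Proof. by rewrite -norm1N opprB. Qed.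

Lemma norm10 : norm1 0 = 0. Proof. by rewrite /norm1 size_poly0 big_ord0. Qed.

Lemma norm1_sum (I : Type) (s : seq I) (P : pred I) (F : I -> {poly R}) :
  norm1 (\sum_(i <- s | P i) F i) <= \sum_(i <- s | P i) norm1 (F i).
Proof.
elim/big_rec2: _ => [|i y1 y2 _ le_y]; first by rewrite norm10.
by rewrite (le_trans (norm1D _ _)) // lerD2l.
Qed.

Lemma norm1X p : norm1 ('X * p) = norm1 p.
Proof.
rewrite (@norm1_widen (size p).+1); last first.
  by rewrite (leq_trans (size_polyMleq _ _)) // size_polyX.
rewrite big_ord_recl coefXM /= normr0 add0r.
by apply: eq_bigr => i _; rewrite coefXM.
Qed.

(** Expanding the first factor into monomials suffices, since multiplication by [X] is an
    isometry. *)
Lemma norm1M p r : norm1 (p * r) <= norm1 p * norm1 r.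
Proof.
rewrite -[p in p * r]coefK poly_def mulr_suml (le_trans (norm1_sum _ _ _)) //.
rewrite mulr_suml ler_sum // => i _; rewrite -scalerAl norm1Z ler_wpM2l //.
by elim: (nat_of_ord i) => [|k IH]; rewrite ?mul1r // exprS -mulrA norm1X.
Qed.

Lemma norm1_nneg p : (forall i, 0 <= p`_i) -> norm1 p = p.[1].
Proof.
move=> p0; rewrite -pint1; apply: eq_bigr => i _.
by rewrite mulr1 ger0_norm.
Qed.

Lemma norm11 : norm1 1 = 1.
Proof.
rewrite norm1_nneg ?hornerC // => i; rewrite coef1; by case: eqP.
Qed.

Lemma norm1C a : norm1 a%:P = `|a|.
Proof. by rewrite -[a%:P]mulr1 mul_polyC norm1Z norm11 mulr1. Qed.

Lemma norm1_X : norm1 'X = 1.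
Proof. by rewrite -[X in norm1 X]mulr1 norm1X norm11. Qed.

Lemma horner1_le p : `|p.[1]| <= norm1 p.
Proof.
rewrite -pint1 -[norm1 p]mulr1; apply: pint_le => k.
by rewrite normr1.
Qed.

Lemma le_pint p f g : (forall i, 0 <= p`_i) -> (forall k, f k <= g k) ->
  pint p f <= pint p g.
Proof. by move=> p0 fg; apply: ler_sum => i _; rewrite ler_wpM2l. Qed.

Lemma coefM_ge0 p r : (forall i, 0 <= p`_i) -> (forall i, 0 <= r`_i) ->
  forall i, 0 <= (p * r)`_i.
Proof. by move=> p0 r0 i; rewrite coefM sumr_ge0 // => j _; rewrite mulr_ge0. Qed.

End PolyMeasure.

(** * The cycle polynomials *)

Section CyclePoly.
Variable R : realType.
Implicit Types (p r : {poly R}) (f : nat -> R).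

Definition cyclep n : {poly R} := \prod_(j < n) (1 + j.+1%:R^-1 *: ('X - 1)).
Definition harm n : R := \sum_(j < n) j.+1%:R^-1.

Local Notation Q := cyclep.

Lemma cyclep0 : Q 0 = 1. Proof. by rewrite /cyclep big_ord0. Qed.

Lemma cyclepS n : Q n.+1 = Q n + n.+1%:R^-1 *: (Q n * ('X - 1)).
Proof. by rewrite /cyclep big_ord_recr /= mulrDr mulr1 scalerAr. Qed.

Lemma harmS n : harm n.+1 = harm n + n.+1%:R^-1.
Proof. by rewrite /harm big_ord_recr. Qed.

Lemma harm_ge0 n : 0 <= harm n.
Proof. by rewrite sumr_ge0 // => i _; rewrite invr_ge0. Qed.

Lemma cyclep_rec n : n%:R *: Q n = 'X * \sum_(m < n) Q m.
Proof.
elim: n => [|n IH]; first by rewrite scale0r big_ord0 mulr0.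
rewrite big_ord_recr /= mulrDr -IH cyclepS scalerDr scalerA mulfV ?pnatr_eq0 //.
rewrite scale1r mulrBr mulr1 -natr1 scalerDl scale1r.
by rewrite [Q n * 'X]mulrC -addrA [Q n + _]addrC subrK.
Qed.

Lemma cyclep_ge0 n i : 0 <= (Q n)`_i.
Proof.
elim: n i => [|n IH] i; first by rewrite cyclep0 coef1; case: eqP.
(* Each factor is the law of a Bernoulli variable of parameter [1/(n+1)]. *)
have -> : Q n.+1 = Q n * ((1 - n.+1%:R^-1)%:P + n.+1%:R^-1 *: 'X).
  rewrite cyclepS -!mul_polyC polyCB polyC1; ring.
apply: coefM_ge0 => // {}i; rewrite coefD coefC coefZ coefX.
have a1 : (n.+1%:R^-1 : R) <= 1 by rewrite invf_le1 ?ler1n.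
have a0 : 0 <= (n.+1%:R^-1 : R) by rewrite invr_ge0.
by case: i => [|[|i]] /=; rewrite ?mulr0 ?mulr1 ?addr0 ?add0r ?subr_ge0.
Qed.

Lemma cyclep_horner1 n : (Q n).[1] = 1.
Proof.
elim: n => [|n IH]; first by rewrite cyclep0 hornerC.
rewrite cyclepS hornerD hornerZ hornerM IH.
by rewrite hornerD hornerN hornerX hornerC subrr; ring.
Qed.

Lemma norm1_cyclep n : norm1 (Q n) = 1.
Proof. by rewrite norm1_nneg ?cyclep_horner1 //; exact: cyclep_ge0. Qed.

Lemma norm1_X1 : norm1 ('X - 1 : {poly R}) <= 2.
Proof. by rewrite (le_trans (norm1B _ _)) // norm1_X norm11. Qed.

Lemma norm1_cyclep_step n : norm1 (Q n.+1 - Q n) <= 2 / n.+1%:R.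
Proof.
rewrite cyclepS addrC addKr norm1Z ger0_norm ?invr_ge0 // mulrC.
rewrite ler_wpM2r ?invr_ge0 // (le_trans (norm1M _ _)) //.
by rewrite norm1_cyclep mul1r norm1_X1.
Qed.

Lemma sum_inv_sqr n : \sum_(j < n) (j.+1%:R^-1 : R) ^+ 2 <= 2.
Proof.
case: n => [|n]; first by rewrite big_ord0.
(* The sharper bound [2 - 1/(n+1)] makes the induction close by telescoping. *)
suff : \sum_(j < n.+1) (j.+1%:R^-1 : R) ^+ 2 <= 2 - n.+1%:R^-1.
  by move/le_trans; apply; rewrite gerBl invr_ge0.
elim: n => [|n IH]; first by rewrite big_ord1 invr1; lra.
rewrite big_ord_recr /=; apply: (le_trans (lerD IH (lexx _))).
rewrite -[n.+2%:R]natr1; have : 0 < n.+1%:R :> R by [].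
move: (n.+1%:R : R) => x x0; have x10 : 0 < x + 1 by lra.
rewrite -subr_ge0.
have -> : 2 - (x + 1)^-1 - (2 - x^-1 + (x + 1)^-1 ^+ 2) =
   x^-1 * (x + 1)^-1 ^+ 2.
  by field; rewrite !lt0r_neq0.
by rewrite mulr_ge0 ?exprn_ge0 // invr_ge0 ltW.
Qed.

(* Stein's identity E[k f(k)] = harm(n) E[f(k+1)], up to a bounded error. *)
Lemma cyclep_deriv n : norm1 ((Q n)^`() - harm n *: Q n) <= 4.
Proof.
suff H : norm1 ((Q n)^`() - harm n *: Q n) <=
   2 * \sum_(j < n) (j.+1%:R^-1 : R) ^+ 2.
  by have := sum_inv_sqr n; lra.
elim: n => [|n IH].
  by rewrite cyclep0 derivC /harm big_ord0 scale0r subrr norm10 big_ord0 mulr0.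
rewrite big_ord_recr /= mulrDr harmS cyclepS; set a := n.+1%:R^-1.
have a1 : a <= 1 :> R by rewrite invf_le1 ?ler1n.
have a0 : 0 <= a :> R by rewrite invr_ge0.
(* The defect is multiplied by a Bernoulli factor, of norm 1, and gains a new error of norm at most
   [2 a^2]; hence the bound by twice the sum of the squares. *)
have -> : (Q n + a *: (Q n * ('X - 1)))^`()
    - (harm n + a) *: (Q n + a *: (Q n * ('X - 1))) =
   ((Q n)^`() - harm n *: Q n) * ((1 - a)%:P + a *: 'X) -
   a ^+ 2 *: (Q n * ('X - 1)).
  rewrite derivD derivZ derivM derivB derivX derivC -!mul_polyC.
  rewrite polyCD polyCB polyC1 expr2 polyCM; ring.
rewrite (le_trans (norm1B _ _)) // lerD //.
  rewrite (le_trans _ IH) // (le_trans (norm1M _ _)) // ler_piMr ?norm1_ge0 //.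
  rewrite (le_trans (norm1D _ _)) // norm1Z norm1_X norm1C.
  by rewrite !ger0_norm ?subr_ge0 //; lra.
rewrite norm1Z ger0_norm ?sqr_ge0 // mulrC ler_wpM2r ?sqr_ge0 //.
by rewrite (le_trans (norm1M _ _)) // norm1_cyclep mul1r norm1_X1.
Qed.

Lemma pint_cyclepS n f : pint (Q n.+1) f =
  pint (Q n) (fun k => (1 - n.+1%:R^-1) * f k + n.+1%:R^-1 * f k.+1).
Proof.
rewrite cyclepS [Q n * _]mulrC mulrBl mul1r pintD pintZ pintB pintX.
rewrite pintDr !pintZr; ring.
Qed.

(** The law is that of a sum of independent Bernoulli variables with mean [harm n]; a factor of
    parameter [a] adds [a (1 - a) <= a] to the variance. *)
Lemma cyclep_var n : pint (Q n) (fun k => (k%:R - harm n) ^+ 2) <= harm n.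
Proof.
elim: n => [|n IH].
  by rewrite cyclep0 /pint size_poly1 big_ord1 /harm big_ord0 subrr expr0n mulr0.
rewrite pint_cyclepS harmS; set a := n.+1%:R^-1.
have a0 : 0 <= a :> R by rewrite invr_ge0.
rewrite (_ : (fun _ => _) = (fun k => (k%:R - harm n) ^+ 2 + a * (1 - a))).
  rewrite pintDr pint_cst cyclep_horner1 mulr1 lerD //.
  by rewrite -[leRHS]mulr1 ler_wpM2l // gerBl.
by apply/funext => k; rewrite -natr1; ring.
Qed.

(** Both sides come from [ln (1 + x) <= x], at [x = 1/(m+1)] for the lower bound and at
    [x = -1/(m+2)] for the upper one. *)
Lemma harm_ln n : `|harm n.+1 - ln n.+1%:R| <= 1.
Proof.
have lnS m : ln m.+2%:R = ln m.+1%:R + ln (1 + m.+1%:R^-1) :> R.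
  rewrite -lnM ?posrE ?addr_gt0 ?invr_gt0 // mulrDr mulr1 mulfV ?pnatr_eq0 //.
  by rewrite natr1.
have lnS' m : ln m.+1%:R = ln m.+2%:R + ln (1 - m.+2%:R^-1) :> R.
  have ? : 0 < 1 - m.+2%:R^-1 :> R by rewrite subr_gt0 invf_lt1 // ltr1n.
  rewrite -lnM ?posrE // mulrBr mulr1 mulfV ?pnatr_eq0 //.
  by rewrite -[m.+2%:R]natr1 addrK.
rewrite ler_norml; apply/andP; split.
  suff : ln n.+1%:R <= harm n.
    move=> H; rewrite harmS; have : 0 <= n.+1%:R^-1 :> R by [].
    by move: _^-1 H => a; lra.
  elim: n => [|n IH]; first by rewrite ln1 harm_ge0.
  rewrite lnS harmS lerD // le_ln1Dx //.
  by apply: (@lt_le_trans _ _ 0); rewrite ?invr_ge0 ?oppr_lt0.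
rewrite lerBlDr; elim: n => [|n IH].
  by rewrite harmS /harm big_ord0 invr1 ln1 add0r addr0.
rewrite harmS; have := lnS' n; have : ln (1 - n.+2%:R^-1) <= - n.+2%:R^-1 :> R.
  by rewrite le_ln1Dx // ltrN2 invf_lt1 // ltr1n.
by move: IH; move: n.+2%:R^-1 => a; lra.
Qed.

(** The 5 is the 4 of [cyclep_deriv] plus the 1 paid in [harm_ln] for replacing the harmonic sum by
    the logarithm. *)
Lemma cyclep_stein n :
  norm1 ('X * (Q n.+1)^`() - ln n.+1%:R *: ('X * Q n.+1)) <= 5.
Proof.
have -> : 'X * (Q n.+1)^`() - ln n.+1%:R *: ('X * Q n.+1) =
    'X * ((Q n.+1)^`() - harm n.+1 *: Q n.+1) +
    (harm n.+1 - ln n.+1%:R) *: ('X * Q n.+1).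
  by rewrite -!mul_polyC polyCB; ring.
rewrite (le_trans (norm1D _ _)) // norm1Z !norm1X norm1_cyclep mulr1.
have := cyclep_deriv n.+1; have := harm_ln n; lra.
Qed.

Lemma cyclep_second_moment n :
  pint (Q n.+1) (fun k => (k%:R - ln n.+1%:R) ^+ 2) <= 2 * ln n.+1%:R + 4.
Proof.
set L := ln _; set h := harm n.+1.
(* This is [(k - L)^2 <= 2 (k - h)^2 + 2 (h - L)^2] with [|h - L| <= 1]. *)
have /le_trans -> // : pint (Q n.+1) (fun k => (k%:R - L) ^+ 2) <=
    pint (Q n.+1) (fun k => 2 * (k%:R - h) ^+ 2 + 2).
  apply: le_pint => [|k]; first exact: cyclep_ge0.
  have /ler_normlP[] := harm_ln n; rewrite -/L -/h => H1 H2.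
  have : (h - L) ^+ 2 <= 1 by nra.
  have := sqr_ge0 (k%:R - h - (h - L)); nra.
rewrite pintDr pintZr pint_cst cyclep_horner1.
have := cyclep_var n.+1; have := harm_ln n; rewrite -/L -/h ler_norml => /andP[].
by lra.
Qed.

(** [L (X - 1) Q] is the difference of [X Q' - L Q], whose norm is the mean of [|k - L|] and thus at
    most [4 sqrt L], and of [X Q' - L X Q], bounded by 5 through Stein's identity. As [L >= 1], the
    total is at most [9 sqrt L]. *)
Lemma cyclep_shift n : 1 <= ln n.+1%:R :> R ->
  norm1 (('X - 1) * Q n.+1) <= 9 / Num.sqrt (ln n.+1%:R).
Proof.
set L := ln _ => L1; set s := Num.sqrt L.
have s2 : s ^+ 2 = L by rewrite sqr_sqrtr // (le_trans ler01).
have s1 : 1 <= s by rewrite -sqrtr1 ler_wsqrtr.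
have dev : norm1 ('X * (Q n.+1)^`() - L *: Q n.+1) <= 4 * s.
  apply: norm1_le => f f1; rewrite pintB pint_deriv pintZ -pintZr -pintBr.
  (* The inequality [y <= y^2 / (2 s) + s / 2] plays the role of Cauchy-Schwarz and leads to the
     second moment. *)
  have /le_trans -> // : pint (Q n.+1) (fun k => k%:R * f k - L * f k) <=
      pint (Q n.+1) (fun k => (2 * s)^-1 * (k%:R - L) ^+ 2 + s / 2).
    apply: le_pint => [|k]; first exact: cyclep_ge0.
    rewrite -mulrBl (le_trans (ler_norm _)) // normrM.
    rewrite (le_trans (ler_piMr _ (f1 k))) //.
    rewrite -real_normK ?num_real //; move: `|_| => y.
    rewrite -subr_ge0.
    have -> : (2 * s)^-1 * y ^+ 2 + s / 2 - y = (2 * s)^-1 * (y - s) ^+ 2.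
      by field; rewrite gt_eqF //; lra.
    by rewrite mulr_ge0 ?sqr_ge0 // invr_ge0; lra.
  rewrite pintDr pintZr pint_cst cyclep_horner1 mulr1.
  have H : (2 * s)^-1 * pint (Q n.+1) (fun k => (k%:R - L) ^+ 2) <=
      (2 * s)^-1 * (2 * L + 4).
    by rewrite ler_wpM2l ?cyclep_second_moment // invr_ge0; lra.
  rewrite (le_trans (lerD H (lexx _))) // -s2 -subr_ge0.
  have -> : 4 * s - ((2 * s)^-1 * (2 * s ^+ 2 + 4) + s / 2) =
      s^-1 * (5 / 2 * s ^+ 2 - 2).
    by field; rewrite gt_eqF //; lra.
  by rewrite mulr_ge0 ?invr_ge0; nra.
rewrite ler_pdivlMr ?(lt_le_trans ltr01) //.
rewrite -(ler_pM2l (lt_le_trans ltr01 s1)).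
have -> : s * (norm1 (('X - 1) * Q n.+1) * s) =
    norm1 (L *: (('X - 1) * Q n.+1)).
  by rewrite norm1Z ger0_norm ?(le_trans ler01) // -s2; ring.
have -> : L *: (('X - 1) * Q n.+1) = ('X * (Q n.+1)^`() - L *: Q n.+1) -
    ('X * (Q n.+1)^`() - L *: ('X * Q n.+1)).
  by rewrite -!mul_polyC; ring.
have := cyclep_stein n; have := dev; rewrite -/L => H1 H2.
by rewrite (le_trans (norm1B _ _)) //; lra.
Qed.

Lemma near_ln A : \forall n \near \oo, A <= ln n.+1%:R :> R.
Proof.
near=> n; rewrite -[A]expRK ler_ln ?posrE ?expR_gt0 //.
rewrite (@le_trans _ _ n%:R) ?ler_nat //; near: n; exact: nbhs_infty_ger.
Unshelve. all: by end_near. Qed.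

End CyclePoly.

(** * Convolution of sequences of polynomials *)

Section Convolution.
Variable A : comNzRingType.
Implicit Types a b c : nat -> A.

Definition conv a b n := \sum_(i < n.+1) a i * b (n - i)%N.

(** Truncation turns [conv] into a coefficient of a product of polynomials, from which commutativity
    and associativity are inherited. *)
Lemma conv_poly N a b n : (n < N)%N ->
  conv a b n = (\poly_(i < N) a i * \poly_(i < N) b i)`_n.
Proof.
move=> nN; rewrite coefM; apply: eq_bigr => i _.
rewrite !coef_poly (leq_trans (ltn_ord i)) //.
by rewrite (leq_ltn_trans (leq_subr i n)).
Qed.

Lemma convC a b n : conv a b n = conv b a n.
Proof. by rewrite !(@conv_poly n.+1) // mulrC. Qed.

Lemma convA a b c n : conv (conv a b) c n = conv a (conv b c) n.
Proof.
pose p (d : nat -> A) := \poly_(i < n.+1) d i.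
have in1 (i : 'I_n.+1) : (n - i < n.+1)%N by rewrite ltnS leq_subr.
transitivity (p a * p b * p c)`_n.
  rewrite coefM; apply: eq_bigr => i _.
  by rewrite -conv_poly // [(p c)`_ _]coef_poly in1.
rewrite -mulrA coefM; apply: eq_bigr => i _.
by rewrite -conv_poly // [(p a)`_ _]coef_poly ltn_ord.
Qed.

Lemma eq_conv a a' b b' n : (forall i, (i <= n)%N -> a i = a' i) ->
  (forall i, (i <= n)%N -> b i = b' i) -> conv a b n = conv a' b' n.
Proof.
by move=> ea eb; apply: eq_bigr => i _; rewrite ea ?eb ?leq_subr // -ltnS.
Qed.

Lemma convDl a a' b n : conv (fun i => a i + a' i) b n = conv a b n + conv a' b n.
Proof. by rewrite -big_split /=; apply: eq_bigr => i _; rewrite mulrDl. Qed.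

(** On generating series in [z], multiplying the [n]-th term by [n] is the derivation [z d/dz]. *)
Lemma conv_derivation a b n : conv a b n *+ n =
  conv (fun i => a i *+ i) b n + conv a (fun i => b i *+ i) n.
Proof.
rewrite -big_split -sumrMnl /=; apply: eq_bigr => i _.
by rewrite mulrnAl mulrnAr -mulrnDr subnKC // -ltnS.
Qed.

End Convolution.

(** * Dominated convergence for series, and summability from a recursion *)

Section Tannery.
Variable R : realType.

Lemma ler_sum_ord (f : nat -> R) n m : (forall i, 0 <= f i) -> (n <= m)%N ->
  \sum_(i < n) f i <= \sum_(i < m) f i.
Proof.
move=> f0 nm; rewrite -!(big_mkord xpredT f) (big_cat_nat (leq0n n) nm) /=.
by rewrite lerDl sumr_ge0.
Qed.

Lemma summable_tail (b : nat -> R) (B : R) : (forall m, 0 <= b m) ->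
  (forall N, \sum_(m < N) b m <= B) ->
  forall e, 0 < e -> exists M, forall N, \sum_(M <= m < N) b m <= e.
Proof.
move=> b0 bB e e0.
pose s n := \sum_(m < n) b m.
have [M HM] : exists M, sup (range s) - e < s M.
  have : has_sup (range s).
    split; first by exists (s 0%N); exists 0%N.
    by exists B => _ [n _ <-]; exact: bB.
  by case/(sup_adherent e0) => _ [M _ <-] HM; exists M.
exists M => N; have [NM|MN] := leqP N M.
  by rewrite big_geq // ltW.
have : s N <= sup (range s).
  by apply: ub_le_sup; [exists B => _ [n _ <-]; exact: bB | exists N].
rewrite /s -!(big_mkord xpredT b) (big_cat_nat (leq0n M) (ltnW MN)) /=.
rewrite (big_mkord _ b) -/(s M); move: HM; lra.
Qed.

Lemma tannery (b : nat -> R) (B : R) (u : nat -> nat -> R) :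
  (forall m, 0 <= b m) -> (forall N, \sum_(m < N) b m <= B) ->
  (forall n m, `|u n m| <= b m) -> (forall m, u n m @[n --> \oo] --> (0 : R)) ->
  (\sum_(m < n.+1) u n m) @[n --> \oo] --> (0 : R).
Proof.
move=> b0 bB ub u0; apply/cvgr0Pnorm_lt => e e0.
have [M HM] := summable_tail b0 bB (divr_gt0 e0 (ltr0n _ 2)).
have : (\sum_(m < M) `|u n m|) @[n --> \oo] --> (0 : R).
  elim: M {HM} => [|M IH].
    rewrite (_ : (fun n => _) = cst 0); first exact: cvg_cst.
    by apply/funext => n; rewrite big_ord0.
  rewrite (_ : (fun n => _) = (fun n => \sum_(m < M) `|u n m| + `|u n M|)).
    have := cvgD IH (cvg_norm (u0 M)); rewrite normr0 addr0; exact.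
  by apply/funext => n; rewrite big_ord_recr.
move/cvgr0Pnorm_lt => /(_ _ (divr_gt0 e0 (ltr0n _ 2))) H.
near=> n.
have Mn : (M <= n.+1)%N by apply: leqW; near: n; exact: nbhs_infty_ge.
rewrite (le_lt_trans (ler_norm_sum _ _ _)) //.
rewrite -(big_mkord xpredT (fun m => `|u n m|)) (big_cat_nat (leq0n M) Mn) /=.
rewrite [ltRHS]splitr ltr_leD //.
  rewrite big_mkord (le_lt_trans (ler_norm _)) //; near: n; exact: H.
by rewrite (le_trans _ (HM n.+1)) // ler_sum.
Unshelve. all: by end_near. Qed.

(** Summing the recursion over [m < N] gives [sum m b_m <= C sum b_m]. Terms with [m > C] weigh more
    on the left than on the right, so they are paid for by the finitely many terms with [m <= C]. *)
Lemma summable_rec (b l : nat -> R) (C : nat) : (forall m, 0 <= b m) ->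
  (forall m, 0 <= l m) -> (forall N, \sum_(m < N) l m <= C%:R) ->
  (forall m, m%:R * b m <= conv l b m) ->
  forall N, \sum_(m < N) b m <= C.+1%:R * \sum_(m < C.+1) b m.
Proof.
move=> b0 l0 lC rec N.
have H : \sum_(m < N) m%:R * b m <= C%:R * \sum_(m < N) b m.
  apply: (@le_trans _ _ (\sum_(m < N) conv l b m)); first exact: ler_sum.
  (* The truncated sum of the convolution is part of the value at 1 of a product of two truncated
     polynomials; all coefficients being non-negative, the rest can be added. *)
  pose p d : {poly R} := \poly_(i < N) d i.
  have p0 d : (forall i : nat, 0 <= d i) -> forall i, 0 <= (p d)`_i.
    by move=> d0 i; rewrite coef_poly; case: ifP.
  have p1 d : (p d).[1] = \sum_(i < N) d i.
    by rewrite horner_poly; apply: eq_bigr => i _; rewrite expr1n mulr1.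
  apply: (@le_trans _ _ (p l * p b).[1]); last first.
    by rewrite hornerM !p1 ler_wpM2r // sumr_ge0.
  rewrite -pint1 (@pint_widen _ (maxn N (size (p l * p b)))) ?leq_maxr //.
  rewrite -(big_mkord xpredT (fun i => (p l * p b)`_i * 1)).
  rewrite (@big_cat_nat _ _ _ N) ?leq_maxl //= big_mkord.
  rewrite -[leLHS]addr0 lerD //.
    by apply: ler_sum => i _; rewrite mulr1 -conv_poly.
  by apply: sumr_ge0 => i _; rewrite mulr1 coefM_ge0 //; apply: p0.
(* Termwise [b_m <= (m - C) b_m + (C + 1) g_m]: the factor [m - C] is at least 1 beyond [C], and
   [m + 1 >= 1] remains below. The first part sums to at most 0. *)
pose g m := if (m < C.+1)%N then b m else 0.
have g0 m : 0 <= g m by rewrite /g; case: ifP.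
have gC : \sum_(m < N) g m <= \sum_(m < C.+1) b m.
  apply: le_trans (ler_sum_ord g0 (leq_addl C.+1 N)) _.
  by rewrite [leRHS](big_ord_widen (C.+1 + N)) ?leq_addr // [leRHS]big_mkcond.
have : \sum_(m < N) b m <=
    \sum_(m < N) (m%:R * b m - C%:R * b m + C.+1%:R * g m).
  apply: ler_sum => m _; rewrite /g; case: ltnP => mC.
    have := mulr_ge0 (ler0n R m) (b0 m); rewrite -natr1; nra.
  have : C.+1%:R <= m%:R :> R by rewrite ler_nat.
  by have := b0 m; rewrite -natr1; nra.
rewrite big_split /= sumrB -!mulr_sumr => /le_trans; apply.
rewrite -[leRHS]add0r lerD ?subr_le0 // ler_wpM2l //.
Qed.

End Tannery.

(** * Cycle polynomials under summable multipliers *)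

Section CycleConvolution.
Variable R : realType.
Local Notation Q := (@cyclep R).

Lemma cyclep_shift0 : norm1 (('X - 1) * Q n) @[n --> \oo] --> (0 : R).
Proof.
rewrite -cvg_shiftS; apply/cvgr0Pnorm_lt => e e0.
near=> n; rewrite ger0_norm ?norm1_ge0 //.
have L1 : 1 <= ln n.+1%:R :> R by near: n; exact: near_ln.
have Le : (10 / e) ^+ 2 <= ln n.+1%:R :> R by near: n; exact: near_ln.
rewrite (le_lt_trans (cyclep_shift L1)) // ltr_pdivrMr; last first.
  by rewrite sqrtr_gt0 (lt_le_trans ltr01).
rewrite mulrC -ltr_pdivrMr // (@lt_le_trans _ _ (10 / e)) //.
  by rewrite ltr_pM2r ?invr_gt0 // ltr_nat.
by rewrite -[leLHS]ger0_norm ?divr_ge0 ?(ltW e0) // -sqrtr_sqr ler_wsqrtr.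
Unshelve. all: by end_near. Qed.

Lemma cyclep_drift k m : norm1 (Q k - Q (m + k)) <= m%:R * (2 / k.+1%:R).
Proof.
elim: m => [|m IH]; first by rewrite subrr norm10 mul0r.
rewrite -natr1 mulrDl mul1r.
rewrite -[_ - _](subrKA (Q (m + k))) (le_trans (norm1D _ _)) // lerD //.
rewrite norm1_distC (le_trans (norm1_cyclep_step _ _)) //.
by rewrite ler_wpM2l // lef_pV2 ?posrE // ler_nat ltnS leq_addl.
Qed.

Lemma cyclep_drift0 m : norm1 (Q k - Q (m + k)) @[k --> \oo] --> (0 : R).
Proof.
apply/cvgr0Pnorm_lt => e e0; near=> k; rewrite ger0_norm ?norm1_ge0 //.
rewrite (le_lt_trans (cyclep_drift _ _)) // mulrA ltr_pdivrMr // [ltRHS]mulrC.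
rewrite -ltr_pdivrMr // (@lt_le_trans _ _ k.+1%:R) //.
rewrite (@le_lt_trans _ _ k%:R) ?ltr_nat //; near: k; exact: nbhs_infty_ger.
Unshelve. all: by end_near. Qed.

(** Replacing a multiplier by its value at 1 thus costs a multiple of [(X - 1) Q_n], which is
    negligible by [cyclep_shift0]. *)
Lemma poly_sub_horner1 (p : {poly R}) : exists r, p - p.[1]%:P = r * ('X - 1).
Proof.
by rewrite -polyC1; apply/factor_theorem; rewrite rootE !hornerE subrr.
Qed.

(* By Tannery's theorem: each h_m u_(n-m) is asymptotically d h_m(1) Q_n, since
   both the shift by one and the change of n move Q_n by o(1). *)
Lemma conv_cyclep (h u : nat -> {poly R}) (B C d : R) :
  (forall N, \sum_(m < N) norm1 (h m) <= B) -> (forall n, norm1 (u n) <= C) ->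
  norm1 (u n - d *: Q n) @[n --> \oo] --> (0 : R) ->
  norm1 (conv h u n - (d * \sum_(m < n.+1) (h m).[1]) *: Q n)
    @[n --> \oo] --> (0 : R).
Proof.
move=> hB uC ud.
have C0 : 0 <= C by rewrite (le_trans (norm1_ge0 _) (uC 0)).
pose v n m := norm1 (h m * u (n - m)%N - (d * (h m).[1]) *: Q n).
have v0 : (\sum_(m < n.+1) v n m) @[n --> \oo] --> (0 : R).
  apply: (@tannery _ (fun m => (C + `|d|) * norm1 (h m)) ((C + `|d|) * B)).
  - by move=> m; rewrite mulr_ge0 ?norm1_ge0 ?addr_ge0.
  - by move=> N; rewrite -mulr_sumr ler_wpM2l // addr_ge0.
  - move=> n m; rewrite ger0_norm ?norm1_ge0 // (le_trans (norm1B _ _)) //.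
    rewrite mulrDl lerD //.
      by rewrite (le_trans (norm1M _ _)) // mulrC ler_wpM2r ?norm1_ge0.
    rewrite norm1Z norm1_cyclep mulr1 normrM ler_wpM2l //; exact: horner1_le.
  - move=> m; rewrite -(cvg_shiftn m).
    have [r hr] := poly_sub_horner1 (h m).
    have bnd n : 0 <= v (n + m)%N m <= norm1 (h m) * norm1 (u n - d *: Q n) +
       `|d| * norm1 r * norm1 (('X - 1) * Q n) +
       `|d * (h m).[1]| * norm1 (Q n - Q (m + n)%N).
      rewrite norm1_ge0 /v addnK [(n + m)%N]addnC.
      (* Three errors: [u_n] against [d Q_n], the multiplier against its value at 1, and [Q_n]
         against [Q_(m+n)]. Each vanishes for fixed [m]. *)
      have -> : h m * u n - (d * (h m).[1]) *: Q (m + n) =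
         h m * (u n - d *: Q n) + d *: ((h m - (h m).[1]%:P) * Q n) +
         (d * (h m).[1]) *: (Q n - Q (m + n)%N).
        by rewrite -!mul_polyC polyCM; ring.
      rewrite hr (le_trans (norm1D _ _)) // norm1Z lerD //.
      rewrite (le_trans (norm1D _ _)) // norm1Z -mulrA lerD ?norm1M //.
      by rewrite -mulrA ler_wpM2l // norm1M.
    apply: (squeeze_cvgr (f := cst 0)); last 2 first.
    - exact: cvg_cst.
    - have := cvgD (cvgD (cvgM (cvg_cst (norm1 (h m))) ud)
          (cvgM (cvg_cst (`|d| * norm1 r)) cyclep_shift0))
          (cvgM (cvg_cst `|d * (h m).[1]|) (cyclep_drift0 m)).
      rewrite !mulr0 !addr0; exact.
    - by near=> n; exact: bnd.
apply: (squeeze_cvgr (f := cst 0) (h := fun n => \sum_(m < n.+1) v n m)) => //.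
  near=> n; rewrite norm1_ge0 /= mulr_sumr scaler_suml -sumrB.
  exact: norm1_sum.
exact: cvg_cst.
Unshelve. all: by end_near. Qed.

End CycleConvolution.

(** * Logarithmic derivatives of generating series *)

Section LogDerivative.
Variable R : realType.
Local Notation Q := (@cyclep R).
Implicit Types a e h P lam : nat -> {poly R}.

(** In generating series this solves [z h' = e h] with [h(0) = 1]. Each coefficient depends on all
    earlier ones, so the recursion builds the list of values. *)
Lemma logderiv_exists e : e 0%N = 0 ->
  exists2 h, h 0%N = 1 & forall n, h n *+ n = conv e h n.
Proof.
move=> e0.
(* Since [e 0 = 0], the convolution at the new index involves earlier coefficients only, and
   dividing by the index determines the new one. *)
pose next (s : seq {poly R}) := (size s)%:R^-1 *:
  \sum_(i < size s) e i.+1 * s`_((size s).-1 - i)%N.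
have [l l0 lS] : exists2 l : nat -> seq {poly R},
    l 0%N = [:: 1] & forall n, l n.+1 = rcons (l n) (next (l n)).
  by exists (fun n => iter n (fun s => rcons s (next s)) [:: 1]).
have sl n : size (l n) = n.+1.
  by elim: n => [|n IH]; rewrite ?l0 // lS size_rcons IH.
have lE n : (l n.+1)`_n.+1 = next (l n) by rewrite lS nth_rcons sl ltnn eqxx.
have lh n i : (i <= n)%N -> (l n)`_i = (l i)`_i.
  elim: n => [|n IH]; first by rewrite leqn0 => /eqP ->.
  rewrite leq_eqVlt => /predU1P[-> //|]; rewrite ltnS => le_in.
  by rewrite lS nth_rcons sl ltnS le_in IH.
exists (fun n => (l n)`_n) => [|[|n]]; first by rewrite l0.
  by rewrite mulr0n /conv big_ord1 e0 mul0r.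
rewrite lE /next sl -scaler_nat scalerA mulfV ?pnatr_eq0 // scale1r.
rewrite /conv [RHS]big_ord_recl e0 mul0r add0r.
by apply: eq_bigr => i _; rewrite lh ?leq_subr //= subSS.
Qed.

Lemma logderiv_unique e a b : e 0%N = 0 -> a 0%N = b 0%N ->
  (forall n, a n *+ n = conv e a n) -> (forall n, b n *+ n = conv e b n) ->
  a =1 b.
Proof.
move=> e0 ab0 ea eb n; elim/ltn_ind: n => -[//|n] IH.
have : a n.+1 *+ n.+1 = b n.+1 *+ n.+1.
  rewrite ea eb /conv ![LHS]big_ord_recl ![RHS]big_ord_recl e0 !mul0r !add0r.
  by apply: eq_bigr => i _; rewrite IH // subSS ltnS leq_subr.
move/(congr1 (fun p => n.+1%:R^-1 *: p)).
by rewrite -[a _ *+ _]scaler_nat -[b _ *+ _]scaler_nat !scalerA mulVf ?pnatr_eq0 // !scale1r.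
Qed.

(** The coefficients of [X z / (1 - z)], the logarithmic derivative [z d/dz log] of [(1 - z)^(-X)],
    whose coefficients are the cycle polynomials. *)
Definition constX n : {poly R} := if n is _.+1 then 'X else 0.

Lemma cyclep_logderiv n : Q n *+ n = conv constX Q n.
Proof.
rewrite -scaler_nat cyclep_rec /conv big_ord_recl mul0r add0r.
rewrite mulr_sumr (reindex_inj rev_ord_inj) /=.
by apply: eq_bigr => i _.
Qed.

(** Logarithmic derivatives add under products: if that of [h] is [lam - constX], then that of [h Q]
    is [lam], and [P] solves the same equation with the same initial value. *)
Lemma logderiv_conv lam P : lam 0%N = 0 -> P 0%N = 1 ->
  (forall n, P n *+ n = conv lam P n) ->
  exists h, [/\ h 0%N = 1,
    (forall n, h n *+ n = conv (fun i => lam i - constX i) h n) &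
    forall n, P n = conv h Q n].
Proof.
move=> lam0 P0 HP.
have [|h h0 Hh] := @logderiv_exists (fun i => lam i - constX i).
  by rewrite lam0 subrr.
exists h; split => //; apply: (logderiv_unique lam0) => //.
  by rewrite P0 /conv big_ord1 h0 cyclep0 mulr1.
move=> n; rewrite conv_derivation.
rewrite (eq_conv (a' := conv (fun i => lam i - constX i) h) (b' := Q)) //.
rewrite (eq_conv (a := h) (a' := h) (b' := conv constX Q)) //; last first.
  by move=> i _; exact: cyclep_logderiv.
rewrite convA -[conv h _ n]convA.
rewrite (eq_conv (a := conv h constX) (a' := conv constX h) (b' := Q)) //;
  last by move=> i _; exact: convC.
rewrite convA -convDl; apply: eq_conv => // i _; exact: subrK.
Qed.

(** [summable_rec] makes the quotient [h] summable, so [conv_cyclep] applies with [u = Q]; the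
    assumed limit at 1 then tells which multiple of [Q_n] occurs. *)
Lemma cyclep_approx lam P (C c : R) : lam 0%N = 0 -> P 0%N = 1 ->
  (forall n, P n *+ n = conv lam P n) ->
  (forall N, \sum_(m < N) norm1 (lam m.+1 - 'X) <= C) ->
  (P n).[1] @[n --> \oo] --> c ->
  norm1 (P n - c *: Q n) @[n --> \oo] --> (0 : R).
Proof.
move=> lam0 P0 HP lamC Pc.
have [h [h0 Hh hQ]] := logderiv_conv lam0 P0 HP.
pose e i := lam i - constX i.
have C0 : 0 <= C by have := lamC 0%N; rewrite big_ord0.
have eC N : \sum_(m < N) norm1 (e m) <= (Num.bound C)%:R.
  rewrite (le_trans _ (ltW (archi_boundP C0))) //.
  case: N => [|N]; first by rewrite big_ord0.
  by rewrite big_ord_recl /e lam0 subrr norm10 add0r.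
have rec m : m%:R * norm1 (h m) <=
    conv (fun i => norm1 (e i)) (fun i => norm1 (h i)) m.
  rewrite -[m%:R]normr_nat -norm1Z scaler_nat Hh (le_trans (norm1_sum _ _ _)) //.
  by apply: ler_sum => i _; exact: norm1M.
have hB := summable_rec (fun m => norm1_ge0 (h m)) (fun m => norm1_ge0 (e m))
  eC rec.
have Qd : norm1 (Q n - 1 *: Q n) @[n --> \oo] --> (0 : R).
  rewrite (_ : (fun n => _) = cst 0); first exact: cvg_cst.
  by apply/funext => n; rewrite scale1r subrr norm10.
have Q1 n : norm1 (Q n) <= 1 by rewrite norm1_cyclep.
have := conv_cyclep hB Q1 Qd; set s := fun n => _ => s0.
pose H n := \sum_(m < n.+1) (h m).[1].
(* As [Q_n(1) = 1], evaluating the approximation at 1 compares [P_n(1)] with the partial sums of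
   [h_m(1)], which therefore tend to [c]. *)
have PH : ((P n).[1] - H n) @[n --> \oo] --> (0 : R).
  apply/norm_cvg0P; apply: (squeeze_cvgr (f := cst 0) (h := s)) => //.
    near=> n; rewrite normr_ge0 /=.
    have := horner1_le (P n - (1 * H n) *: Q n).
    by rewrite hornerD hornerN hornerZ cyclep_horner1 mulr1 mul1r /s -hQ mul1r.
  exact: cvg_cst.
have bnd n : 0 <= norm1 (P n - c *: Q n) <= s n + `|H n - c|.
  rewrite norm1_ge0 /=.
  have -> : P n - c *: Q n = (P n - (1 * H n) *: Q n) + (H n - c) *: Q n.
    by rewrite -!mul_polyC mul1r polyCB; ring.
  rewrite (le_trans (norm1D _ _)) // norm1Z norm1_cyclep mulr1 lerD2r.
  by rewrite /s hQ.
apply: (squeeze_cvgr (f := cst 0) (h := fun n => s n + `|H n - c|)).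
- by near=> n; exact: bnd.
- exact: cvg_cst.
- have Hc : (H n - c) @[n --> \oo] --> (0 : R).
    rewrite (_ : (fun n => _) = (fun n => ((P n).[1] - c) - ((P n).[1] - H n))).
      have := cvgB (cvgB Pc (cvg_cst c)) PH; rewrite subrr subr0; exact.
    by apply/funext => n; ring.
  have := cvgD s0 (cvg_norm Hc); rewrite normr0 addr0; exact.
Unshelve. all: by end_near. Qed.

(** The constants [t^m] are summable multipliers, so [V n] is close to [c g_n Q_n] with [g_n >= 1].
    Positivity of [c] keeps the normalizing factor [V_n(1)] away from 0. *)
Lemma cyclep_approx_avg P (C c t : R) : 0 < c -> 0 <= t < 1 ->
  (forall n, norm1 (P n) <= C) ->
  norm1 (P n - c *: Q n) @[n --> \oo] --> (0 : R) ->
  let V n := \sum_(m < n.+1) t ^+ m *: P (n - m)%N in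
  norm1 ((V n).[1]^-1 *: V n - Q n) @[n --> \oo] --> (0 : R).
Proof.
move=> c0 /andP[t0 t1] PC Pc V.
pose g n := \sum_(m < n.+1) t ^+ m.
have gB N : \sum_(m < N) norm1 ((t ^+ m)%:P) <= (1 - t)^-1.
  rewrite (eq_bigr (fun m : 'I_N => t ^+ m)); last first.
    by move=> m _; rewrite norm1C ger0_norm ?exprn_ge0.
  rewrite -[leRHS]mul1r ler_pdivlMr ?subr_gt0 // mulrC -[1 - t]opprB mulNr -subrX1.
  by rewrite opprB gerBl exprn_ge0.
have := @conv_cyclep R (fun m => (t ^+ m)%:P) P _ C c gB PC Pc; set s := fun n => _ => s0.
have sE n : s n = norm1 (V n - (c * g n) *: Q n).
  rewrite /s; congr (norm1 (_ - _)).
    by apply: eq_bigr => m _; rewrite mul_polyC.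
  by congr ((c * _) *: _); apply: eq_bigr => m _; rewrite hornerC.
have g1 n : 1 <= g n.
  by rewrite /g big_ord_recl expr0 lerDl sumr_ge0 // => i _; rewrite exprn_ge0.
have vs n : `|(V n).[1] - c * g n| <= s n.
  rewrite sE; have := horner1_le (V n - (c * g n) *: Q n).
  by rewrite hornerD hornerN hornerZ cyclep_horner1 mulr1.
(* [4 / c] is [2 / c], from [V_n(1) >= c / 2], times 2, for the error of [V n] and that of its value
   at 1. *)
apply: (squeeze_cvgr (f := cst 0) (h := fun n => (4 / c) * s n)).
- near=> n; rewrite norm1_ge0 /=.
  have sc : s n <= c / 2.
    rewrite (le_trans (ler_norm _)) //; near: n.
    by move/cvgr0Pnorm_le : s0; apply; rewrite divr_gt0.
  have v0 : c / 2 <= (V n).[1].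
    have := vs n; rewrite ler_norml => /andP[H _].
    by have := ler_wpM2l (ltW c0) (g1 n); lra.
  have v1 : 0 < (V n).[1] by rewrite (lt_le_trans _ v0) // divr_gt0.
  have -> : (V n).[1]^-1 *: V n - Q n =
      (V n).[1]^-1 *: ((V n - (c * g n) *: Q n) - ((V n).[1] - c * g n) *: Q n).
    rewrite [in RHS]scalerBl opprB [in RHS]addrA subrK scalerBr scalerA.
    by rewrite mulVf ?gt_eqF // scale1r.
  rewrite norm1Z gtr0_norm ?invr_gt0 //.
  apply: (@le_trans _ _ ((V n).[1]^-1 * (2 * s n))).
    rewrite ler_wpM2l ?invr_ge0 ?(ltW v1) // (le_trans (norm1B _ _)) // -sE.
    rewrite norm1Z norm1_cyclep mulr1; have := vs n; lra.
  rewrite (_ : 4 / c * s n = (c / 2)^-1 * (2 * s n)); last first.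
    by field; rewrite gt_eqF.
  rewrite ler_wpM2r ?mulr_ge0 ?norm1_ge0 //.
  by rewrite lef_pV2 ?posrE ?divr_gt0.
- exact: cvg_cst.
- have := cvgM (cvg_cst (4 / c)) s0; rewrite mulr0; exact.
Unshelve. all: by end_near. Qed.

End LogDerivative.

(** * The central limit theorem *)

Section CompactSupport.
Variable R : realType.
Local Notation mu := (@lebesgue_measure R).
Variables (F : R -> R) (K : R).
Hypothesis cF : continuous F.
Hypothesis F0 : forall x, K <= `|x| -> F x = 0.

Lemma csupp_bounded : exists2 M, 0 < M & forall x, `|F x| <= M.
Proof.
have /compact_bounded/pinfty_ex_gt0[M M0 HM] : compact (F @` `[- K, K]%classic).
  apply: continuous_compact; last exact: segment_compact.
  exact: continuous_subspaceT.
exists M => // x; have [Kx|xK] := leP K `|x|.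
  by rewrite F0 // normr0 ltW.
apply: HM; exists x => //=; rewrite in_itv /=.
by move: xK; rewrite ltr_norml => /andP[x1 x2]; rewrite !ltW.
Qed.

Lemma csupp_integrable : mu.-integrable setT (EFin \o F).
Proof.
have -> : F = F \_ `[- K, K].
  apply/funext => x; rewrite patchE; case: ifPn => // /negP xK.
  apply: F0; rewrite leNgt; apply/negP; rewrite ltr_norml => /andP[x1 x2].
  by apply: xK; rewrite inE /= in_itv /= !ltW.
rewrite -restrict_EFin; apply/integrable_restrict => //=; rewrite setTI.
apply: continuous_compact_integrable; first exact: segment_compact.
exact: continuous_subspaceT.
Qed.

Lemma csupp_unif (e : R) : 0 < e ->
  exists2 d, 0 < d & forall x y, `|x - y| < d -> `|F x - F y| <= e.
Proof.
move=> e0.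
pose P (d x : R) := forall y, `|y - x| < d -> `|F y - F x| <= e.
have : \forall d \near 0^'+, `[- K - 1, K + 1]%classic `<=` P d.
  apply: (compact_near_coveringP _).1; first exact: segment_compact.
  move=> x _.
  have /cvgrPdist_lt/(_ _ (divr_gt0 e0 (ltr0n _ 2)))/nbhs_ballP[r /= r0 Hr] := @cF x.
  have r2 : 0 < r / 2 by rewrite divr_gt0.
  exists (ball x (r / 2), [set d | 0 < d < r / 2]) => /=.
    split; first exact: nbhsx_ballx.
    near=> d => /=; apply/andP; split => //; near: d; exact: nbhs_right_lt.
  move=> [x' d] /= [xx' /andP[d0 dr]] y yx'.
  have H1 : `|F x - F x'| < e / 2.
    by apply: Hr; apply: le_ball xx'; lra.
  have H2 : `|F x - F y| < e / 2.
    apply: Hr; rewrite /ball /=; move: xx'; rewrite /ball /= => xx'.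
    rewrite -(subrKA x') (le_lt_trans (ler_normD _ _)) //.
    by move: yx'; rewrite distrC; lra.
  have := ler_distD (F x) (F y) (F x'); rewrite (distrC (F y) (F x)); lra.
move=> Hd.
(* With [d <= 1], a point [y] beyond [K + 1] forces [x] beyond [K], where both values are 0. *)
have [d [d0 d1 dP]] : exists d, [/\ 0 < d, d <= 1 & `[- K - 1, K + 1]%classic `<=` P d].
  near (0 : R)^'+ => d; exists d; split => //.
    near: d; exact: nbhs_right_le.
  by near: d.
exists d => // x y xy; have [yK|yK] := leP `|y| (K + 1).
  apply: dP => //=; rewrite in_itv /=; move: yK; rewrite ler_norml => /andP[].
  by move=> *; apply/andP; split; lra.
rewrite (F0 (x := y)) ?(F0 (x := x)) ?subrr ?normr0 ?ltW //; last lra.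
by have := ler_dist_dist y x; rewrite distrC ler_norml => /andP[_]; lra.
Unshelve. all: by end_near. Qed.

End CompactSupport.

(** * Stein's equation and the Gaussian limit *)

Section Gauss.
Variable R : realType.
Local Notation mu := (@lebesgue_measure R).

Definition gauss_weight (x : R) := expR (- x ^+ 2 / 2).
Local Notation phi := gauss_weight.

Lemma continuous_gauss_weight : continuous phi.
Proof.
move=> x; apply: continuous_comp; last exact: continuous_expR.
apply: cvgM; last exact: cvg_cst.
by apply: cvgN; exact: exprn_continuous.
Qed.

Lemma normal_pdf_gauss_weight x : normal_pdf 0 1 x = (Num.sqrt (2 * pi))^-1 * phi x.
Proof.
rewrite /normal_pdf oner_eq0 /normal_peak /normal_fun subr0 !expr1n.
by rewrite mul1r mulr_natl.
Qed.

(** The solution of [g' - x g = F] is [exp(x^2/2)] times the primitive of [F phi] from minus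
    infinity. The vanishing Gaussian integral gives it compact support, so [g] is bounded and its
    derivative uniformly continuous. *)
Lemma stein_solution (F : R -> R) (K : R) : 0 < K -> continuous F ->
  (forall x, K <= `|x| -> F x = 0) -> \int[mu]_x (F x * phi x) = 0 ->
  exists2 g : R -> R, (forall x : R, is_derive x 1 g (x * g x + F x)) &
    forall x, K <= `|x| -> g x = 0.
Proof.
move=> K0 cF F0 int0; pose f x := F x * phi x.
have cf : continuous f by move=> x; apply: cvgM; [exact: cF|exact: continuous_gauss_weight].
have f0 x : K <= `|x| -> f x = 0 by move=> Kx; rewrite /f F0 // mul0r.
have intf := csupp_integrable cf f0.
pose G x := \int[mu]_(t in `]-oo, x]) f t.
have dG (x : R) : is_derive x 1 G (f x).
  have [|||dG1 dG2] := @continuous_FTC1 R f -oo%O x (x + 1) _ _ _ (cf x).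
  - by rewrite ltrDl.
  - exact: (@integrableS _ _ _ _ setT).
  - exact: ltNyr.
  - by rewrite -dG2 derive1E; apply: DeriveDef.
(* To the right of the support the primitive equals the full integral, which is 0; to the left the
   integrand itself vanishes. *)
have G0 x : K <= `|x| -> G x = 0.
  rewrite /G ler_normr => /orP[Kx|Kx].
    rewrite -[RHS]int0 Rintegral_mkcond; apply: eq_Rintegral => t _.
    rewrite patchE; case: ifPn => // /negP tx; rewrite [RHS]f0 //.
    rewrite ler_normr (le_trans Kx) //; rewrite leNgt; apply/negP => xt.
    by apply: tx; rewrite inE /= in_itv /= ltW.
  transitivity (\int[mu]_(t in `]-oo, x]) (0 : R)).
    apply: eq_Rintegral => t; rewrite inE /= in_itv /= => tx; apply: f0.
    by rewrite ler_normr; apply/orP; right; lra.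
  by rewrite /Rintegral integral0.
exists (fun x => expR (x ^+ 2 / 2) * G x); last by move=> x /G0 ->; rewrite mulr0.
move=> x.
have d1 : is_derive x 1 (fun y : R => expR (y ^+ 2 / 2)) (x * expR (x ^+ 2 / 2)).
  have dsq : is_derive x 1 (fun y : R => y ^+ 2 / 2) x.
    rewrite (_ : (fun y => _) = (fun y : R => 2^-1 *: y ^+ 2)); last first.
      by apply/funext => y; rewrite mulrC.
    by apply: is_derive_eq; rewrite /GRing.scale /=; field.
  rewrite mulrC; exact: (is_derive1_comp (is_derive_expR _) dsq).
apply: is_derive_eq.
rewrite /GRing.scale /= /f /phi mulrA [_ * (F x * _)]mulrCA -expRD.
rewrite mulNr subrr expR0 mulr1 [x * _ * G x]mulrC; ring.
Qed.

(** In the scaled variable [w] one step of [k] is [1/s] with [s = sqrt(ln n)], so the derivative of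
    [g] is nearly [s] times a difference of [g]. What remains of [F] is the expression bounded by
    Stein's identity, divided by [s]. *)
Lemma cyclep_stein_cvg (F : R -> R) (K : R) : 0 < K -> continuous F ->
  (forall x, K <= `|x| -> F x = 0) -> \int[mu]_x (F x * phi x) = 0 ->
  pint (cyclep R n) (fun k => F ((k%:R - ln n%:R) / Num.sqrt (ln n%:R)))
    @[n --> \oo] --> (0 : R).
Proof.
move=> K0 cF F0 int0; have [g dg g0] := stein_solution K0 cF F0 int0.
have cg : continuous g.
  move=> x; apply/differentiable_continuous/derivable1_diffP.
  by have [] := dg x.
pose g' x := x * g x + F x.
have cg' : continuous g'.
  by move=> x; apply: cvgD; [apply: cvgM; [exact: cvg_id|exact: cg]|exact: cF].
have g'0 x : K <= `|x| -> g' x = 0 by move=> Kx; rewrite /g' g0 // F0 // mulr0 addr0.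
have [M M0 gM] := csupp_bounded cg g0.
rewrite -cvg_shiftS; apply/cvgr0Pnorm_le => e e0.
have [d d0 Hd] := csupp_unif cg' g'0 (divr_gt0 e0 (ltr0n _ 2)).
near=> n => /=.
have L1 : 1 <= ln n.+1%:R :> R by near: n; exact: near_ln.
(* This bound gives [1/s < d], the modulus of continuity; the next one gives [5 M / s <= e / 2]. *)
have Ld : (d^-1 + 1) ^+ 2 <= ln n.+1%:R by near: n; exact: near_ln.
have LM : (10 * M / e) ^+ 2 <= ln n.+1%:R by near: n; exact: near_ln.
set L : R := ln n.+1%:R in L1 Ld LM *; set s := Num.sqrt L.
have s2 : s ^+ 2 = L by rewrite sqr_sqrtr // (le_trans ler01).
have s1 : 1 <= s by rewrite -sqrtr1 ler_wsqrtr.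
have s0 : 0 < s by rewrite (lt_le_trans ltr01).
have sd : s^-1 < d.
  rewrite invf_plt ?posrE // (@lt_le_trans _ _ (d^-1 + 1)) ?ltrDl //.
  rewrite -[leLHS]ger0_norm ?addr_ge0 ?invr_ge0 ?(ltW d0) // -sqrtr_sqr.
  exact: ler_wsqrtr.
have sM : 10 * M / e <= s.
  rewrite -[leLHS]ger0_norm ?divr_ge0 ?mulr_ge0 ?(ltW M0) ?(ltW e0) // -sqrtr_sqr.
  exact: ler_wsqrtr.
pose w k : R := (k%:R - L) / s.
have wS k : w k.+1 = w k + s^-1 by rewrite /w -natr1 addrAC mulrDl mul1r.
pose G k := g (w k).
have mvt k : `|g' (w k) - s * (G k.+1 - G k)| <= e / 2.
  have lt_w : w k < w k.+1 by rewrite wS ltrDl invr_gt0.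
  have [z] := @MVT R g g' (w k) (w k.+1) lt_w (fun x _ => dg x)
    (continuous_subspaceT cg).
  rewrite in_itv /= => /andP[z1 z2] E.
  have D : w k.+1 - w k = s^-1 by rewrite wS addrC addKr.
  rewrite /G E D mulrCA mulfV ?gt_eqF // mulr1; apply: Hd.
  by rewrite ltr0_norm ?subr_lt0 // opprB; move: z2; rewrite wS; lra.
(* Because [s^2 = L], the terms [s G k] and [w G k] combine into [k G k / s]. *)
have FE k : F (w k) = (g' (w k) - s * (G k.+1 - G k)) -
    s^-1 * (k%:R * G k - L * G k.+1).
  have -> : k%:R = w k * s + L by rewrite /w divfK ?subrK // gt_eqF.
  by rewrite -s2 /g' /G; field; rewrite gt_eqF.
rewrite (_ : (fun k => _) = (fun k => (g' (w k) - s * (G k.+1 - G k)) -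
    s^-1 * (k%:R * G k - L * G k.+1))); last by apply/funext => k; rewrite -FE.
rewrite pintBr (le_trans (ler_normB _ _)) // (splitr e) lerD //.
  by have := pint_le (cyclep R n.+1) mvt; rewrite norm1_cyclep mul1r.
rewrite pintZr normrM gtr0_norm ?invr_gt0 // ler_pdivrMl // mulrC.
have -> : pint (cyclep R n.+1) (fun k => k%:R * G k - L * G k.+1) =
    pint ('X * (cyclep R n.+1)^`() - L *: ('X * cyclep R n.+1)) G.
  by rewrite pintBr pintZr pintB pint_deriv pintZ pintX.
have := pint_le ('X * (cyclep R n.+1)^`() - L *: ('X * cyclep R n.+1))
  (fun k => gM (w k)).
move/le_trans; apply; apply: (@le_trans _ _ (5 * M)).
  by rewrite ler_wpM2r ?(ltW M0) //; exact: cyclep_stein.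
by move: sM; rewrite ler_pdivrMr //; lra.
Unshelve. all: by end_near. Qed.

(** A compactly supported stand-in for the constant 1: a multiple of it is subtracted from [F] to
    make the Gaussian integral vanish. *)
Definition bump (K x : R) := Num.max 0 (Num.min 1 (K + 1 - `|x|)).

Lemma bump_cont K : continuous (bump K).
Proof.
rewrite (_ : bump K = cst 0 \max (cst 1 \min (fun x => K + 1 - `|x|))) //.
move=> x; apply: continuous_max; first exact: cst_continuous.
apply: continuous_min; first exact: cst_continuous.
by apply: cvgB; [exact: cvg_cst|exact: norm_continuous].
Qed.

Lemma bump01 K x : 0 <= bump K x <= 1.
Proof. by rewrite /bump le_max lexx ge_max ler01 ge_min lexx. Qed.

Lemma bump_out K x : K + 1 <= `|x| -> bump K x = 0.
Proof. by move=> Kx; rewrite /bump max_l // ge_min subr_le0 Kx orbT. Qed.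

Lemma bump_in K x : `|x| <= K -> bump K x = 1.
Proof. by move=> Kx; rewrite /bump min_l ?max_r //; lra. Qed.

(** Chebyshev's inequality in pointwise form: it bounds the mass seen by [bump] from below by the
    second moment. *)
Lemma bump_ge K x : 0 < K -> 1 - K ^- 2 * x ^+ 2 <= bump K x.
Proof.
move=> K0; have [xK|xK] := leP `|x| K.
  rewrite bump_in // gerBl; apply: mulr_ge0; last exact: sqr_ge0.
  by rewrite invr_ge0 exprn_ge0 // ltW.
apply: (@le_trans _ _ 0); last by case/andP: (bump01 K x).
rewrite subr_le0 -[x ^+ 2]real_normK ?num_real // ler_pdivlMl ?exprn_gt0 // mulr1.
by rewrite ler_pXn2r ?nnegrE ?normr_ge0 ?(ltW K0) ?(ltW xK).
Qed.

Lemma integrable_gauss_weight : mu.-integrable setT (EFin \o phi).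
Proof.
have Z0 : Num.sqrt (2 * pi) != 0 :> R by rewrite gt_eqF // sqrtr_gt0 mulr_gt0 // pi_gt0.
have := integrableZl measurableT (Num.sqrt (2 * pi)) (@integrable_normal_pdf R 0 1).
by apply: eq_integrable => // x _ /=; rewrite normal_pdf_gauss_weight -EFinM mulVKf.
Qed.

Lemma Rintegral_gauss_weight : \int[mu]_x phi x = Num.sqrt (2 * pi).
Proof.
have Z0 : Num.sqrt (2 * pi) != 0 :> R by rewrite gt_eqF // sqrtr_gt0 mulr_gt0 // pi_gt0.
have -> : phi = (fun x => Num.sqrt (2 * pi) * normal_pdf 0 1 x).
  by apply/funext => x; rewrite normal_pdf_gauss_weight mulVKf.
rewrite RintegralZl //; last exact: integrable_normal_pdf.
by rewrite /Rintegral integral_normal_pdf mulr1.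
Qed.

Lemma bump_weight_cvg :
  \int[mu]_x (bump n%:R x * phi x) @[n --> \oo] --> Num.sqrt (2 * pi).
Proof.
rewrite -Rintegral_gauss_weight.
have mf n : measurable_fun setT (fun x => (bump n%:R x * phi x)%:E).
  apply/measurable_EFinP; apply: continuous_measurable_fun => x.
  by apply: cvgM; [exact: bump_cont|exact: continuous_gauss_weight].
have mphi : measurable_fun setT (fun x => (phi x)%:E).
  apply/measurable_EFinP; apply: continuous_measurable_fun.
  exact: continuous_gauss_weight.
have ptw : {ae mu, forall x, setT x ->
    (bump n%:R x * phi x)%:E @[n --> \oo] --> (phi x)%:E}.
  apply: aeW => x _; apply: cvg_EFin; first by near=> n.
  apply: (@cvg_trans _ (cst (phi x) @ \oo)); last exact: cvg_cst.
  apply: near_eq_cvg; near=> n => /=.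
  by rewrite bump_in ?mul1r //; near: n; exact: nbhs_infty_ger.
have dom : {ae mu, forall x n, setT x ->
    (`|(bump n%:R x * phi x)%:E| <= (phi x)%:E)%E}.
  apply: aeW => x n _; rewrite /= lee_fin normrM [X in _ * X]ger0_norm ?expR_ge0 //.
  by rewrite ler_piMl ?expR_ge0 //; case/andP: (bump01 n%:R x) => b0 b1; rewrite ger0_norm.
have [_ _ H] := @dominated_convergence _ _ R mu setT measurableT _ _ _ mf mphi ptw
  integrable_gauss_weight dom.
apply: fine_cvg; rewrite fineK //.
  exact: integrable_fin_num integrable_gauss_weight.
Unshelve. all: by end_near. Qed.

(** With [r = I / b], the function [F - r bump] has Gaussian integral 0, so [cyclep_stein_cvg]
    applies. The mean of [bump] is close to 1 for a wide bump, and [r] is close to [I / Z]; the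
    width is fixed before [n] grows. *)
Lemma cyclep_clt (F : R -> R) (K : R) : 0 < K -> continuous F ->
  (forall x, K <= `|x| -> F x = 0) ->
  pint (cyclep R n) (fun k => F ((k%:R - ln n%:R) / Num.sqrt (ln n%:R)))
    @[n --> \oo] --> (Num.sqrt (2 * pi))^-1 * \int[mu]_x (F x * phi x).
Proof.
move=> K0 cF F0; set Z := Num.sqrt (2 * pi); set I := \int[mu]_x _.
have Z0 : 0 < Z by rewrite sqrtr_gt0 mulr_gt0 // pi_gt0.
pose b (m : nat) := \int[mu]_x (bump m%:R x * phi x).
have bZ : b m @[m --> \oo] --> Z by exact: bump_weight_cvg.
have rI : I / b m @[m --> \oo] --> Z^-1 * I.
  rewrite [Z^-1 * I]mulrC; apply: cvgM; first exact: cvg_cst.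
  by apply: cvgV; rewrite ?gt_eqF.
have sm : 6 * (m.+1%:R^-1 * m.+1%:R^-1) @[m --> \oo] --> (0 : R).
  have := cvgM (cvg_cst (6 : R)) (cvgM (@cvg_harmonic R) (@cvg_harmonic R)).
  rewrite !mulr0; exact.
have err0 : `|I / b m.+1 - Z^-1 * I| + `|I / b m.+1| * (6 * (m.+1%:R^-1 * m.+1%:R^-1))
    @[m --> \oo] --> (0 : R).
  have rI' := rI; rewrite -cvg_shiftS in rI'.
  have := cvgD (cvg_norm (cvgB rI' (cvg_cst (Z^-1 * I)))) (cvgM (cvg_norm rI') sm).
  rewrite subrr normr0 mulr0 addr0; exact.
rewrite -cvg_shiftS; apply/cvgrPdist_le => e e0.
have e2 : 0 < e / 2 by rewrite divr_gt0.
have [m [bm0 Hm]] : exists m, 0 < b m.+1 /\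
   `|I / b m.+1 - Z^-1 * I| + `|I / b m.+1| * (6 * (m.+1%:R^-1 * m.+1%:R^-1)) < e / 2.
  near \oo => m; exists m; split.
    near: m; have bZ' := bZ; rewrite -cvg_shiftS in bZ'; exact: cvgr_gt bZ' _ Z0.
  rewrite (le_lt_trans (ler_norm _)) //; near: m.
  by move/cvgr0Pnorm_lt : err0; apply.
pose r := I / b m.+1; pose Fr x := F x - r * bump m.+1%:R x.
have cFr : continuous Fr.
  move=> x; apply: cvgB; first exact: cF.
  by apply: cvgM; [exact: cvg_cst|exact: bump_cont].
have Fr0 x : Num.max K (m.+1%:R + 1) <= `|x| -> Fr x = 0.
  by rewrite ge_max => /andP[x1 x2]; rewrite /Fr F0 // bump_out // mulr0 subr0.
have cFp : continuous (fun x => F x * phi x).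
  by move=> x; apply: cvgM; [exact: cF|exact: continuous_gauss_weight].
have cBp : continuous (fun x => bump m.+1%:R x * phi x).
  by move=> x; apply: cvgM; [exact: bump_cont|exact: continuous_gauss_weight].
have iF : mu.-integrable setT (EFin \o (fun x => F x * phi x)).
  by apply: (csupp_integrable (K := K)) => // x Kx; rewrite F0 // mul0r.
have iB : mu.-integrable setT (EFin \o (fun x => bump m.+1%:R x * phi x)).
  by apply: (csupp_integrable (K := m.+1%:R + 1)) => // x Kx; rewrite bump_out // mul0r.
have intFr : \int[mu]_x (Fr x * phi x) = 0.
  transitivity (\int[mu]_x (F x * phi x - r * (bump m.+1%:R x * phi x))).
    by apply: eq_Rintegral => x _; rewrite /Fr mulrBl mulrA.
  rewrite RintegralB //; last by apply: (integrableZl measurableT r iB).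
  by rewrite RintegralZl // -/I -/(b m.+1) /r divfK ?subrr // gt_eqF.
have K1 : 0 < Num.max K (m.+1%:R + 1) by rewrite lt_max K0.
have := cyclep_stein_cvg K1 cFr Fr0 intFr; rewrite -cvg_shiftS.
move/cvgr0Pnorm_le => /(_ _ e2) Hst.
near=> n => /=.
have L1 : 1 <= ln n.+1%:R :> R by near: n; exact: near_ln.
have EFr : `|pint (cyclep R n.+1)
    (fun k => Fr ((k%:R - ln n.+1%:R) / Num.sqrt (ln n.+1%:R)))| <= e / 2.
  by near: n.
set L : R := ln n.+1%:R in L1 EFr *.
pose w k : R := (k%:R - L) / Num.sqrt L.
pose E f := pint (cyclep R n.+1) (fun k => f (w k)).
(* The 6 bounds the second moment of [w], at most [(2 L + 4) / L] with [L >= 1]. *)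
have EB : `|E (bump m.+1%:R) - 1| <= 6 * (m.+1%:R^-1 * m.+1%:R^-1).
  have B1 : E (bump m.+1%:R) <= 1.
    have /le_trans -> // : E (bump m.+1%:R) <= pint (cyclep R n.+1) (fun=> 1).
      apply: le_pint => [|k]; first exact: cyclep_ge0.
      by case/andP: (bump01 m.+1%:R (w k)).
    by rewrite pint1 cyclep_horner1.
  rewrite ler0_norm ?subr_le0 // opprB lerBlDl -lerBlDr.
  have H : pint (cyclep R n.+1) (fun k => 1 - m.+1%:R ^- 2 * w k ^+ 2) <=
      E (bump m.+1%:R).
    by apply: le_pint => [|k]; [exact: cyclep_ge0|exact: bump_ge].
  apply: le_trans H; rewrite pintBr pint1 cyclep_horner1 pintZr.
  rewrite lerD2l lerN2 -exprVn expr2 mulrC ler_wpM2r ?mulr_ge0 //.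
  have -> : (fun k => w k ^+ 2) = (fun k => L^-1 * (k%:R - L) ^+ 2).
    apply/funext => k; rewrite /w expr_div_n sqr_sqrtr ?(le_trans ler01) //.
    by rewrite mulrC.
  rewrite pintZr ler_pdivrMl ?(lt_le_trans ltr01) //.
  by have := @cyclep_second_moment R n; rewrite -/L; lra.
have -> : pint (cyclep R n.+1) (fun k => F ((k%:R - L) / Num.sqrt L)) =
    E Fr + r * E (bump m.+1%:R).
  by rewrite /E -pintZr -pintDr; congr pint; apply/funext => k; rewrite /Fr subrK.
have -> : Z^-1 * I - (E Fr + r * E (bump m.+1%:R)) =
    - ((r - Z^-1 * I) + r * (E (bump m.+1%:R) - 1) + E Fr) by ring.
rewrite normrN (le_trans (ler_normD _ _)) // (splitr e) lerD //.
rewrite (le_trans _ (ltW Hm)) // (le_trans (ler_normD _ _)) // lerD2l.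
by rewrite normrM ler_wpM2l.
Unshelve. all: by end_near. Qed.

End Gauss.

(** * The measure of a finitely additive content *)

Section DistanceToComplement.
Context (R : realType) (X : pmetricType R).

(** The function is the distance to the complement, which is non-empty so that the infimum is a
    genuine one. *)
Lemma open_positivity (U : set X) : open U -> U != setT ->
  exists d : X -> R, [/\ continuous d, forall x, 0 <= d x &
    U = [set x | 0 < d x]].
Proof.
move=> oU UT.
have [y0 Uy0] : exists y, ~ U y.
  apply: contrapT => /forallNP H; move/eqP: UT; apply.
  by apply/seteqP; split => // x _; exact: contrapT (H x).
pose S x := [set mdist x y | y in ~` U].
have S0 x : nonempty (S x) by exists (mdist x y0), y0.
have lbS x : lbound (S x) 0 by move=> _ [y _ <-]; exact: mdist_ge0.
have hS x : has_inf (S x) by split => //; exists 0.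
pose d x := inf (S x).
have d0 x : 0 <= d x by apply: lb_le_inf.
have dxy x y : d x <= mdist x y + d y.
  rewrite -lerBlDl; apply: lb_le_inf => // _ [z Uz <-].
  rewrite lerBlDl (le_trans _ (metric_triangle x y z)) //.
  by apply: inf_lbound; [exists 0 | exists z].
exists d; split => //.
  move=> x; apply/cvgrPdist_lt => e e0; apply/nbhs_ballP; exists e => //= y.
  rewrite ballEmdist /= => xy; rewrite (le_lt_trans _ xy) // ler_norml.
  have := dxy x y; have := dxy y x; rewrite (metric_sym y x).
  by move=> h1 h2; apply/andP; split; lra.
apply/seteqP; split => x /=.
  move=> Ux; have /nbhs_ballP[e /= e0 eU] : nbhs x U by exact: open_nbhs_nbhs.
  rewrite (lt_le_trans e0) //; apply: lb_le_inf => // _ [y Uy <-].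
  by rewrite leNgt; apply/negP => xy; apply/Uy/eU; rewrite ballEmdist.
move=> dx; apply: contrapT => Ux; move: dx; rewrite ltNge => /negP; apply.
apply: inf_lbound; first by exists 0.
by exists x => //; rewrite mdistxx.
Qed.

End DistanceToComplement.

Section ContentMeasure.
Context (R : realType) (X : pmetricType R).
Variable m : set X -> R.
Hypothesis cX : compact [set: X].
Hypothesis m_ge0 : forall A, 0 <= m A.
Hypothesis m_setT : m setT = 1.
Hypothesis m_add : forall A B, A `&` B = set0 -> m (A `|` B) = m A + m B.

Lemma content0 : m set0 = 0.
Proof.
have := m_add (setI0 set0); rewrite setU0 => /eqP.
by rewrite -subr_eq subrr eq_sym => /eqP.
Qed.

Lemma contentD A B : A `<=` B -> m (B `\` A) = m B - m A.
Proof.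
move=> AB; rewrite -[X in _ = m X - _](setDUK AB) m_add ?setDIK //.
by rewrite addrAC subrr add0r.
Qed.

Lemma content_le A B : A `<=` B -> m A <= m B.
Proof. by move=> AB; rewrite -subr_ge0 -contentD. Qed.

Lemma contentU_le A B : m (A `|` B) <= m A + m B.
Proof.
have -> : A `|` B = A `|` (B `\` A).
  by apply/seteqP; split=> x /=; have := pselect (A x); tauto.
rewrite m_add ?setDIK // lerD2l; apply: content_le; exact: subDsetl.
Qed.

Definition open_content A : \bar R := if `[< open A >] then (m A)%:E else +oo%E.

Lemma open_content_ge0 A : (0 <= open_content A)%E.
Proof. by rewrite /open_content; case: ifP; rewrite ?lee_fin ?leey. Qed.

Lemma open_content0 : open_content set0 = 0%E.
Proof. by rewrite /open_content asboolT ?content0 //; exact: open0. Qed.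

(* Every set is measurable in this carrier, so that [mu_ext] ranges over all
   countable covers; covers by non-open sets are given infinite weight. *)
Let discrete : measurableType _ := g_sigma_algebraType [set: set X].

Definition content_outer : set X -> \bar R :=
  @mu_ext _ discrete R (open_content : set discrete -> \bar R).

HB.instance Definition _ := isOuterMeasure.Build R X content_outer
  (@mu_ext0 _ discrete R _ open_content0 open_content_ge0)
  (@mu_ext_ge0 _ discrete R _ open_content_ge0)
  (@le_mu_ext _ discrete R open_content)
  (@mu_ext_sigma_subadditive _ discrete R _ open_content_ge0).

Lemma content_outer_le E (A : (set X)^nat) : (forall k, open (A k)) ->
  E `<=` \bigcup_k A k -> (content_outer E <= \sum_(k <oo) (m (A k))%:E)%E.
Proof.
move=> oA EA; apply: ereal_inf_lbound; exists A.
  by split => // i; exact: sub_sigma_algebra.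
by apply: eq_eseriesr => k _; rewrite /open_content asboolT.
Qed.

Lemma le_content_outer E x :
  (forall A : (set X)^nat, (forall k, open (A k)) -> E `<=` \bigcup_k A k ->
     (x <= \sum_(k <oo) (m (A k))%:E)%E) -> (x <= content_outer E)%E.
Proof.
move=> H; apply: le_ereal_inf_tmp => _ [A [_ EA] <-].
have [oA|] := pselect (forall k, open (A k)).
  rewrite (eq_eseriesr (g := fun k => (m (A k))%:E)); first exact: H.
  by move=> k _; rewrite /open_content asboolT.
move=> /existsNP[k oAk].
rewrite (@eseries_pinfty _ _ _ k) ?leey //.
  by move=> n _; rewrite -ltNye (lt_le_trans _ (open_content_ge0 _)).
by rewrite /open_content asboolF.
Qed.

Lemma content_outer_open U : open U -> (content_outer U <= (m U)%:E)%E.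
Proof.
move=> oU; pose A k := if k is 0%N then U else set0.
apply: (le_trans (@content_outer_le U A _ _)).
- by case=> //= _; exact: open0.
- by move=> x Ux; exists 0%N.
rewrite nneseries_recl //; last by move=> *; rewrite lee_fin.
rewrite [X in (_ + X)%E]eseries0 ?adde0 // => -[|k] _ _ //=.
by rewrite content0.
Qed.

(** Compactness prevents a loss of mass: a countable open cover has a finite subcover, to which
    finite subadditivity of [m] applies. *)
Lemma content_outer_setT : (1%:E <= content_outer setT)%E.
Proof.
apply: le_content_outer => A oA cA.
move: cX; rewrite compact_cover => /(_ nat setT A (fun k _ => oA k) cA)[D _ cD].
pose N := (\max_(k <- D) k).+1.
apply: (@le_trans _ _ (\sum_(k < N) (m (A k))%:E)%E); last first.
  rewrite -(big_mkord xpredT (fun k => (m (A k))%:E)).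
  by apply: nneseries_lim_ge => k _ _; rewrite lee_fin.
rewrite sumEFin lee_fin -m_setT.
have bigU n : m (\bigcup_(k < n) A k) <= \sum_(k < n) m (A k).
  elim: n => [|n IH]; first by rewrite bigcup_mkord !big_ord0 content0.
  rewrite bigcup_mkord !big_ord_recr -bigcup_mkord /=.
  by rewrite (le_trans (contentU_le _ _)) // lerD2r.
apply: le_trans (bigU N); apply: content_le => x /cD[k Dk Akx].
by exists k => //=; rewrite /N ltnS; apply: leq_bigmax_seq.
Qed.

(* With [U = {0 < d}] and [a_j = 1/(j+1)], the annuli [{a_(j+2) < d < a_j}] have
   summable content by telescoping, so that the part of [V `&` U] where [d] is
   small is negligible. *)
Lemma content_outer_split U V : open U -> open V ->
  (content_outer (V `&` U) + content_outer (V `&` ~` U) <= (m V)%:E)%E.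
Proof.
move=> oU oV; have [->|UT] := eqVneq U setT.
  by rewrite setCT setI0 setIT outer_measure0 adde0 content_outer_open.
have [d [cd d0 Ud]] := open_positivity oU UT.
pose a j : R := j.+1%:R^-1.
have a_le i j : (i <= j)%N -> a j <= a i by move=> ij; rewrite lef_pV2 ?posrE ?ler_nat.
have a_lt i j : (i < j)%N -> a j < a i by move=> ij; rewrite ltf_pV2 ?posrE ?ltr_nat.
pose phi j := m (V `&` [set x | a j <= d x]).
have phi_le i j : (i <= j)%N -> phi i <= phi j.
  move=> ij; apply: content_le => x [Vx /= ax]; split => //=.
  exact: le_trans (a_le _ _ ij) ax.
apply/lee_addgt0Pr => e e0.
have [J HJ] : exists J, forall n, phi n <= phi J + e / 2.
  have hs : has_sup (range phi).
    split; first by exists (phi 0%N), 0%N.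
    by exists (m V) => _ [n _ <-]; apply: content_le => x [].
  have [_ [J _ <-] HJ] := sup_adherent (divr_gt0 e0 (ltr0n R 2)) hs.
  exists J => n; rewrite -lerBlDr (le_trans _ (ltW HJ)) // lerD2r.
  by apply: sup_upper_bound => //; exists n.
(* Consecutive annuli overlap, so they are open and leave no gap. The step of two makes the
   telescoping sum keep two terms at each end, each contributing at most [e / 2]. *)
pose B j := V `&` [set x | a j.+2 < d x < a j].
have cdo := (continuousP d).1 cd.
have oB_gt t : open (V `&` [set x | t < d x]).
  by apply: openI => //; exact: (cdo [set y | t < y] (open_gt (y:=t))).
have oB_lt t : open (V `&` [set x | d x < t]).
  by apply: openI => //; exact: (cdo [set y | y < t] (open_lt (y:=t))).
have oB j : open (B j).
  have -> : B j = (V `&` [set x | a j.+2 < d x]) `&` (V `&` [set x | d x < a j]).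
    apply/seteqP; split => x /=; first by move=> [Vx /andP[]].
    by move=> [[Vx x1] [_ x2]]; split => //; apply/andP.
  exact: openI.
have mB j : m (B j) <= phi j.+2 - phi j.
  rewrite -contentD; last first.
    move=> x [Vx /= ax]; split => //=; apply: le_trans ax.
    by apply: a_le; rewrite leqW.
  apply: content_le => x [Vx /= /andP[x1 x2]]; split; first by split => //=; exact: ltW.
  by move=> [_ /=]; rewrite leNgt x2.
(* The part outside [U] lies in the open set [d < a_(J+1)], disjoint from the set measured by
   [phi J.+1]. *)
have out : (content_outer (V `&` ~` U) <= (m V - phi J.+1)%:E)%E.
  rewrite -contentD; last by move=> x [].
  apply: (@le_trans _ _ (content_outer (V `&` [set x | d x < a J.+1]))).
    apply: le_outer_measure => x [Vx]; rewrite Ud /= => /negP; rewrite -leNgt => dx.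
    by split => //=; rewrite (le_lt_trans dx) // invr_gt0.
  apply: (le_trans (content_outer_open (oB_lt _))); rewrite lee_fin.
  apply: content_le => x [Vx /= dx]; split => // -[_ /=].
  by rewrite leNgt dx.
pose A k := if k is k'.+1 then B (J + k')%N else V `&` [set x | a J.+1 < d x].
have inn : (content_outer (V `&` U) <= (phi J.+1 + e)%:E)%E.
  apply: (le_trans (@content_outer_le _ A _ _)).
  - by case=> [|k]; rewrite /A.
  - move=> x [Vx]; rewrite Ud /= => dx.
    have [aJ|dJ] := ltP (a J.+1) (d x); first by exists 0%N.
    have [n] : exists n, a (J + n).+2 < d x.
      exists (Num.bound (d x)^-1); rewrite invf_plt ?posrE //.
      rewrite (lt_trans (archi_boundP _)) ?invr_ge0 // ltr_nat.
      by move: (Num.bound _) => n; lia.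
    (* The least such [n] also yields the upper bound [d x < a (J + n)], hence membership in the
       annulus. *)
    move=> Pn; case: (ex_minnP (ex_intro (fun n => a (J + n).+2 < d x) n Pn)).
    move=> {Pn}n Pn Hn; exists n.+1 => //=; split => //=; rewrite Pn /=.
    case: n Pn Hn => [|n] _ Hn; first by rewrite addn0 (le_lt_trans dJ) // a_lt.
    have : ~~ (a (J + n).+2 < d x) by apply/negP => /Hn; rewrite ltnn.
    by rewrite -leNgt => /le_lt_trans; apply; rewrite a_lt // addnS.
  apply: lime_le; first by apply: is_cvg_nneseries => k _ _; rewrite lee_fin.
  near=> n; rewrite big_mkord sumEFin lee_fin.
  have n0 : (0 < n)%N by near: n; exact: nbhs_infty_gt.
  rewrite -(prednK n0) big_ord_recl /= lerD //.
    by apply: content_le => x [Vx /= /ltW].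
  have tele k : \sum_(i < k) m (B (J + i)%N) <=
      phi (J + k)%N + phi (J + k).+1 - phi J - phi J.+1.
    elim: k => [|k IH]; first by rewrite big_ord0 addn0; lra.
    by rewrite big_ord_recr /= addnS; have := mB (J + k)%N; lra.
  apply: (le_trans (tele _)); have := HJ (J + n.-1)%N; have := HJ (J + n.-1).+1.
  by have := phi_le _ _ (leqnSn J); lra.
apply: (le_trans (leeD inn out)); rewrite -EFinD lee_fin; lra.
Unshelve. all: by end_near. Qed.

(** Splitting every member of an open cover of the test set reduces the criterion to open test
    sets. *)
Lemma content_outer_caratheodory U : open U -> content_outer.-caratheodory U.
Proof.
move=> oU; apply: le_caratheodory_measurable => E.
apply: le_content_outer => A oA EA.
have H B : (content_outer (E `&` B) <=
    \sum_(k <oo) content_outer (A k `&` B))%E.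
  apply: le_trans (outer_measure_sigma_subadditive content_outer _).
  rewrite -setI_bigcupl; apply: le_outer_measure; exact: setSI.
apply: (le_trans (leeD (H _) (H _))).
rewrite -nneseriesD; [|by move=> *; exact: outer_measure_ge0..].
by apply: lee_nneseries => [k _ _|k _];
  rewrite ?adde_ge0 ?outer_measure_ge0 ?content_outer_split.
Qed.

Definition content_measure : set (borel X) -> \bar R := content_outer.

Lemma borel_caratheodory (A : set (borel X)) : measurable A ->
  content_outer.-caratheodory A.
Proof.
move: A; apply: smallest_sub => /=.
  split => /=; first exact: caratheodory_measurable_set0.
    by move=> A mA; rewrite setTD; exact: caratheodory_measurable_setC.
  exact: caratheodory_measurable_bigcup.
exact: content_outer_caratheodory.
Qed.

Let content_measure0 : content_measure set0 = 0%E.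
Proof. exact: outer_measure0. Qed.

Let content_measure_ge0 A : (0 <= content_measure A)%E.
Proof. exact: outer_measure_ge0. Qed.

Let content_measure_sigma : semi_sigma_additive content_measure.
Proof.
move=> F mF tF mUF; apply: caratheodory_measure_sigma_additive => //.
  by move=> i; exact: borel_caratheodory.
exact: borel_caratheodory.
Qed.

HB.instance Definition _ := isMeasure.Build _ _ _ content_measure
  content_measure0 content_measure_ge0 content_measure_sigma.

Let content_measure_setT : content_measure setT = 1%E.
Proof.
apply/eqP; rewrite eq_le content_outer_setT andbT.
by rewrite (le_trans (content_outer_open openT)) // m_setT.
Qed.

HB.instance Definition _ := @Measure_isProbability.Build _ _ R content_measure
  content_measure_setT.

Lemma content_measure_open U : open U -> (content_measure U <= (m U)%:E)%E.
Proof. exact: content_outer_open. Qed.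

(** Preimages of an open cover of [E] form an open cover of the preimage of [E] with the same
    contents, which gives one inequality. Applied to the complement, it gives the other, total mass
    being 1. *)
Lemma content_measure_invariant (T : X -> X) : continuous T ->
  (forall A, m (T @^-1` A) = m A) ->
  invariant_measure (content_measure : probability (borel X) R) T.
Proof.
move=> cT mT A mA.
have le E : (content_outer (T @^-1` E) <= content_outer E)%E.
  apply: le_content_outer => B oB EB.
  under eq_eseriesr do rewrite -mT.
  apply: content_outer_le => [k|x /EB[k _ Bk]]; last by exists k.
  by move/continuousP : cT; apply.
have mTA : measurable (T @^-1` A : set (borel X)).
  move: A mA; apply: smallest_sub => /=.
    split => /=; first by rewrite preimage_set0; exact: measurable0.
      move=> A mA; rewrite setTD preimage_setC; exact: (@measurableC _ (borel X)).
    move=> F mF; rewrite preimage_bigcup.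
    by apply: (@bigcup_measurable _ (borel X)) => k _; exact: mF.
  move=> A oA; apply: sub_sigma_algebra; by move/continuousP : cT; apply.
pose P : probability (borel X) R := content_measure.
have fA : P A \is a fin_num by exact: fin_num_measure.
have fTA : P (T @^-1` A) \is a fin_num by exact: fin_num_measure.
apply/eqP; rewrite eq_le le /=.
suff : (P A <= P (T @^-1` A))%E by [].
have : (P (~` (T @^-1` A)) <= P (~` A))%E by exact: (le (~` A)).
rewrite !probability_setC // -(fineK fA) -(fineK fTA) -!EFinB !lee_fin; lra.
Qed.

End ContentMeasure.

(** * Unique ergodicity *)

Lemma ultra_cvg_itv (R : realType) (T : Type) (G : set_system T)
    (u : T -> R) (a b : R) : UltraFilter G -> (\forall t \near G, a <= u t <= b) ->
  exists l : R, u @ G --> l.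
Proof.
move=> GU Gu.
have Gab : (u @ G) `[a, b]%classic by apply: filterS Gu => t /=; rewrite in_itv.
have [l [_ cl]] := @segment_compact R a b (u @ G) _ Gab.
exists l => V Vl; have [//|GV] := in_ultra_setVsetC (u @^-1` V) GU.
by have [t [nVt Vt]] := cl (~` V) V GV Vl.
Qed.

Section UniqueErgodicity.
Context (R : realType) (X : pmetricType R) (mu : probability (borel X) R).
Variable T : X -> X.
Hypothesis Hue : uniquely_ergodic mu T.
Variable w : nat -> {poly R}.
Hypothesis w_ge0 : forall n i, 0 <= (w n)`_i.
Hypothesis w_cvg1 : (w n).[1] @[n --> \oo] --> (1 : R).
Hypothesis w_shift : norm1 (('X - 1) * w n) @[n --> \oo] --> (0 : R).
Variable x : X.

Let orbit k := iter k T x.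

(* Any limit of the weighted orbit measures along an ultrafilter is a
   [T]-invariant content, hence dominates [mu] on open sets. *)
Lemma pint_orbit_open (U : set X) (e : R) : open U -> 0 < e ->
  \forall n \near \oo, fine (mu U) - e <= pint (w n) (fun k => \1_U (orbit k)).
Proof.
move=> oU e0; have [cX cT _ uniq] := Hue.
pose u (A : set X) n := pint (w n) (fun k => \1_A (orbit k)).
apply: contrapT => NN.
(* If the claim fails, the exceptional indices occur infinitely often, and an ultrafilter finer than
   [\oo] contains them. The content it defines is too small on [U]. *)
pose N := [set n | ~ fine (mu U) - e <= u U n].
have FN : ProperFilter (within N \oo).
  apply: Build_ProperFilter => H; apply: NN.
  have {}H : \forall n \near \oo, N n -> False by [].
  by apply: filterS H => n Nn; apply: contrapT.
have [G [GU FG]] := ultraFilterLemma FN.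
have GN : G N by apply: FG; exact: withinT.
have Goo : \oo `<=` G
  by move=> A Aoo; apply: FG; apply: filterS Aoo => n An _.
have lim_ex A : exists l : R, u A @ G --> l.
  apply: (@ultra_cvg_itv _ _ _ _ 0 2).
  have : \forall n \near \oo, (w n).[1] <= 2.
    have /cvgrPdist_le/(_ 1 ltr01) := w_cvg1; apply: filterS => n.
    by rewrite ler_norml => /andP[]; lra.
  move/Goo; apply: filterS => n wn; apply/andP; split.
    by apply: sumr_ge0 => i _; rewrite mulr_ge0.
  apply: le_trans wn; rewrite -pint1; apply: le_pint => [|k]; first exact: w_ge0.
  by rewrite indicE; case: (_ \in _).
have [m Hm] := choice lim_ex.
have mE A l : u A @ G --> l -> m A = l.
  by move=> Al; apply: (cvg_unique _ (Hm A) Al); exact: Rhausdorff.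
have w0 A n : 0 <= u A n by apply: sumr_ge0 => i _; rewrite mulr_ge0.
have m0 A : 0 <= m A.
  by apply: (cvgr_to_ge (Hm A)); near=> n; exact: w0.
have m1 : m setT = 1.
  apply: mE; have -> : u setT = (fun n => (w n).[1]).
    by apply/funext => n; rewrite /u indicT pint1.
  exact: cvg_trans (cvg_app _ Goo) w_cvg1.
have mU A B : A `&` B = set0 -> m (A `|` B) = m A + m B.
  move=> AB; apply: mE; have -> : u (A `|` B) = (fun n => u A n + u B n).
    apply/funext => n; rewrite /u -pintDr; congr pint; apply/funext => k.
    rewrite !indicE in_setU; case: (boolP (_ \in A)) => [/set_mem Ak|_]; last by rewrite add0r.
    case: (boolP (_ \in B)) => [/set_mem Bk|_]; last by rewrite addr0.
    by have : (A `&` B) (orbit k) by []; rewrite AB.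
  exact: (cvgD (Hm A) (Hm B)).
(* Along the orbit, preimage by [T] is the shift of the index, so the two averages differ by a test
   of [(X - 1) w n]. *)
have mT A : m (T @^-1` A) = m A.
  apply: mE; have -> : u (T @^-1` A) =
      (fun n => pint (('X - 1) * w n) (fun k => \1_A (orbit k)) + u A n).
    apply/funext => n; rewrite mulrBl mul1r pintB pintX subrK /u.
    by congr pint; apply/funext => k; rewrite !indicE.
  rewrite -[m A]add0r; apply: cvgD => //.
  apply: cvg_trans (cvg_app _ Goo) _.
  apply/norm_cvg0P; apply: (squeeze_cvgr (f := cst 0)
    (h := fun n => norm1 (('X - 1) * w n))) => //; last exact: cvg_cst.
  near=> n; rewrite normr_ge0 /= -[leRHS]mulr1; apply: pint_le => k.
  by rewrite indicE; case: (_ \in _); rewrite ?normr1 ?normr0.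
have bU : measurable (U : set (borel X)) by exact: sub_sigma_algebra.
have muU := uniq _ (content_measure_invariant cX m0 m1 mU cT mT) U bU.
have H1 : fine (mu U) <= m U.
  rewrite -lee_fin fineK ?fin_num_measure // -muU.
  exact: content_measure_open.
have : m U <= fine (mu U) - e.
  apply: (cvgr_to_le (Hm U)); apply: filterS GN => n /negP; rewrite -ltNge.
  exact: ltW.
lra.
Unshelve. all: by end_near. Qed.

Lemma borel_continuous (f : X -> R) : continuous f ->
  measurable_fun setT (f : borel X -> R).
Proof.
move=> cf _; apply: (measurability _ (RGenOpens.measurableE R)) => //.
move=> _ [_ [a [b ->] <-]]; rewrite setTI; apply: sub_sigma_algebra.
by move/continuousP : cf; apply; exact: interval_open.
Qed.

Lemma compact_fun_bounded (f : X -> R) : continuous f ->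
  exists2 M, 0 < M & forall y, `|f y| <= M.
Proof.
have [cX _ _ _] := Hue => cf.
have /compact_bounded/pinfty_ex_gt0[M M0 HM] :
  compact (f @` setT) by apply: continuous_compact => //; exact: continuous_subspaceT.
by exists M => // y; apply: HM; exists y.
Qed.

Lemma borel_integrable (f : X -> R) : continuous f ->
  mu.-integrable setT (EFin \o f).
Proof.
move=> cf; apply: measurable_bounded_integrable => //.
- by rewrite (le_lt_trans (probability_le1 _ _)) ?ltry.
- exact: borel_continuous.
- have [M M0 HM] := compact_fun_bounded cf.
  exists M; split; first exact: num_real.
  by move=> N MN y _; rewrite /= (le_trans (HM y)) // ltW.
Qed.

Lemma count_below (N : nat) (y : R) : 0 <= y <= N%:R ->
  y <= \sum_(j < N) (j%:R < y)%R%:R <= y + 1.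
Proof.
move=> /andP[y0 yN].
(* The induction on [N] cannot keep [y <= N]; it carries the alternative that every index so far has
   been counted. *)
suff [H1 [H2 H3]] : (y <= \sum_(j < N) (j%:R < y)%R%:R
    \/ \sum_(j < N) (j%:R < y)%R%:R = N%:R :> R) /\
    \sum_(j < N) (j%:R < y)%R%:R <= y + 1 /\ \sum_(j < N) (j%:R < y)%R%:R <= N%:R :> R.
  by rewrite H2 andbT; case: H1 => [//|->].
elim: N {yN} => [|N [IH1 [IH2 IH3]]].
  by rewrite big_ord0; split; [right|split => //; rewrite addr_ge0].
rewrite big_ord_recr /= -natr1.
have -> : (N%:R < y)%R%:R = (if N%:R < y then 1 else 0) :> R by case: ifP.
move: (\sum_(j < N) _) IH1 IH2 IH3 => s IH1 IH2 IH3; case: ltP => Ny.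
  split; last by split; lra.
  by case: IH1 => [|->]; [left; lra|right].
by split; [case: IH1 => [|E]; left; lra|split; lra].
Qed.

Lemma Rintegral_probability_cst (r : R) : \int[mu]_y r = r.
Proof.
rewrite Rintegral_cst; last exact: measurableT.
rewrite -[RHS]mulr1; congr (_ * _). exact: (congr1 fine (probability_setT mu)).
Qed.

(* Layer-cake: [f <= (1/N) \sum_(j < N) \1_{f > j/N} <= f + 1/N]. *)
Lemma pint_orbit_ge (f : X -> R) (e : R) : continuous f ->
  (forall y, 0 <= f y <= 1) -> 0 < e ->
  \forall n \near \oo, \int[mu]_y f y - e <= pint (w n) (fun k => f (orbit k)).
Proof.
move=> cf f01 e0.
(* So [1/N <= e / 4]. The layers cost [e / 4], and the rounding [1/N] times a mass of at most 2
   costs [e / 2]. *)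
pose N := (Num.bound (4 / e)).+1.
have N0 : 0 < N%:R :> R by [].
have Ne : N%:R^-1 <= e / 4.
  rewrite -[e / 4]invrK invf_div lef_pV2 ?posrE ?divr_gt0 //.
  rewrite (le_trans (ltW (archi_boundP _))) ?divr_ge0 ?(ltW e0) //.
  by rewrite ler_nat.
pose V j := [set y | j%:R < N%:R * f y].
have oV j : open (V j).
  have cNf : continuous (fun y => N%:R * f y).
    by move=> y; apply: cvgM; [exact: cvg_cst|exact: cf].
  exact: ((continuousP _).1 cNf [set z | j%:R < z] (open_gt (y := _))).
have bV j : measurable (V j : set (borel X)) by exact: sub_sigma_algebra.
have layer y : N%:R * f y <= \sum_(j < N) \1_(V j) y <= N%:R * f y + 1.
  rewrite (eq_bigr (fun j : 'I_N => (j%:R < N%:R * f y)%R%:R)).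
    apply: count_below; have /andP[f0 f1] := f01 y.
    by rewrite mulr_ge0 //= -[leRHS]mulr1 ler_wpM2l.
  by move=> j _; rewrite indicE /V; congr ((_ : bool)%:R); rewrite mem_setE.
have int_le : \int[mu]_y f y <= N%:R^-1 * \sum_(j < N) fine (mu (V j)).
  have mf := borel_continuous cf.
  have : (\int[mu]_y (f y)%:E <=
      \int[mu]_y (\sum_(j < N) (N%:R^-1%:E * (\1_(V j) y)%:E)))%E.
    apply: ge0_le_integral => //.
    - by move=> y _; rewrite lee_fin; case/andP: (f01 y).
    - exact/measurable_EFinP.
    - apply: emeasurable_sum => j _; apply: measurable_funeM.
      exact/measurable_EFinP/measurable_indic.
    - exact: measurableT.
    - move=> y _ /=; under eq_bigr do rewrite -EFinM.
      rewrite sumEFin lee_fin -mulr_sumr ler_pdivlMl //.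
      by case/andP: (layer y).
  rewrite ge0_integral_sum; last 3 first.
  - exact: measurableT.
  - move=> j; apply: measurable_funeM; exact/measurable_EFinP/measurable_indic.
  - by move=> j y _; rewrite mule_ge0 ?lee_fin.
  rewrite (eq_bigr (fun j : 'I_N => (N%:R^-1 * fine (mu (V j)))%:E)); last first.
    move=> j _; rewrite ge0_integralZl_EFin //.
    - rewrite integral_indic // setIT EFinM fineK // fin_num_measure //.
    - exact/measurable_EFinP/measurable_indic.
  rewrite sumEFin -mulr_sumr /Rintegral => H.
  have If : (\int[mu]_y (f y)%:E)%E \is a fin_num.
    exact: integrable_fin_num (borel_integrable cf).
  by rewrite -lee_fin fineK.
have Hn j : \forall n \near \oo,
    fine (mu (V j)) - e / 4 <= pint (w n) (fun k => \1_(V j) (orbit k)).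
  by apply: pint_orbit_open => //; rewrite divr_gt0.
have Hall : \forall n \near \oo, forall j : 'I_N,
    fine (mu (V j)) - e / 4 <= pint (w n) (fun k => \1_(V j) (orbit k)).
  by apply: filter_forall => j; exact: Hn.
near=> n.
have w2 : (w n).[1] <= 2.
  near: n; have /cvgrPdist_le/(_ 1 ltr01) := w_cvg1; apply: filterS => n.
  by rewrite ler_norml => /andP[]; lra.
have HA : forall j : 'I_N,
    fine (mu (V j)) - e / 4 <= pint (w n) (fun k => \1_(V j) (orbit k)).
  by near: n.
have : N%:R^-1 * \sum_(j < N) (fine (mu (V j)) - e / 4) <=
    pint (w n) (fun k => f (orbit k)) + e / 2.
  apply: (@le_trans _ _ (pint (w n) (fun k =>
      N%:R^-1 * \sum_(j < N) \1_(V j) (orbit k)))).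
    rewrite pintZr ler_wpM2l ?invr_ge0 //.
    have -> : pint (w n) (fun k => \sum_(j < N) \1_(V j) (orbit k)) =
        \sum_(j < N) pint (w n) (fun k => \1_(V j) (orbit k)).
      by rewrite exchange_big; apply: eq_bigr => i _; rewrite mulr_sumr.
    by apply: ler_sum => j _; exact: HA.
  apply: (@le_trans _ _ (pint (w n) (fun k => f (orbit k) + N%:R^-1))).
    apply: le_pint => [|k]; first exact: w_ge0.
    rewrite ler_pdivrMl // mulrDr mulfV ?gt_eqF //.
    by case/andP: (layer (orbit k)).
  rewrite pintDr pint_cst lerD2l (le_trans (ler_wpM2l _ w2)) ?invr_ge0 //.
  by have := Ne; lra.
have -> : \sum_(j < N) (fine (mu (V j)) - e / 4) =
    \sum_(j < N) fine (mu (V j)) - N%:R * (e / 4).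
  by rewrite sumrB sumr_const card_ord mulr_natl.
rewrite mulrBr mulKf ?gt_eqF //.
by have := int_le; lra.
Unshelve. all: by end_near. Qed.

(** The upper bound is the lower bound for [1 - f], as the total mass tends to 1. *)
Lemma pint_orbit_cvg01 (f : X -> R) : continuous f ->
  (forall y, 0 <= f y <= 1) ->
  pint (w n) (fun k => f (orbit k)) @[n --> \oo] --> \int[mu]_y f y.
Proof.
move=> cf f01; apply/cvgrPdist_le => e e0.
have cg : continuous (fun y => 1 - f y).
  by move=> y; apply: cvgB; [exact: cvg_cst|exact: cf].
have g01 y : 0 <= 1 - f y <= 1 by case/andP: (f01 y) => *; apply/andP; split; lra.
have e2 : 0 < e / 2 by rewrite divr_gt0.
have Hf := pint_orbit_ge cf f01 e2.
have Hg := pint_orbit_ge cg g01 e2.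
have int_g : \int[mu]_y (1 - f y) = 1 - \int[mu]_y f y.
  rewrite RintegralB //; last 2 first.
  - by apply: (@borel_integrable (fun=> 1)) => y; exact: cvg_cst.
  - exact: borel_integrable.
  by rewrite Rintegral_probability_cst.
near=> n.
have F : \int[mu]_y f y - e / 2 <= pint (w n) (fun k => f (orbit k)).
  by near: n.
have G : \int[mu]_y (1 - f y) - e / 2 <= pint (w n) (fun k => 1 - f (orbit k)).
  by near: n.
have W : `|1 - (w n).[1]| <= e / 2.
  by near: n; move/cvgrPdist_le : w_cvg1; apply.
move: G W F; rewrite int_g pintBr pint1 !ler_norml => G /andP[W1 W2] F.
by apply/andP; split; lra.
Unshelve. all: by end_near. Qed.

Lemma pint_orbit_cvg (f : X -> R) : continuous f ->
  pint (w n) (fun k => f (orbit k)) @[n --> \oo] --> \int[mu]_y f y.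
Proof.
move=> cf; have [M M0 HM] := compact_fun_bounded cf.
pose g y := (f y + M) / (2 * M).
have cg : continuous g.
  move=> y; apply: cvgM; last exact: cvg_cst.
  by apply: cvgD; [exact: cf|exact: cvg_cst].
have M2 : 0 < 2 * M by rewrite mulr_gt0.
have g01 y : 0 <= g y <= 1.
  rewrite /g; have := HM y; rewrite ler_norml => /andP[h1 h2].
  apply/andP; split; first by rewrite divr_ge0 ?(ltW M2) //; lra.
  by rewrite ler_pdivrMr //; lra.
have fg y : f y = 2 * M * g y - M by rewrite /g mulrCA mulfV ?gt_eqF // mulr1 addrK.
have := cvgB (cvgM (cvg_cst (2 * M)) (pint_orbit_cvg01 cg g01))
   (cvgM (cvg_cst M) w_cvg1).
have -> : \int[mu]_y f y = 2 * M * \int[mu]_y g y - M * 1.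
  transitivity (\int[mu]_y (2 * M * g y - M)).
    by apply: eq_Rintegral => y _; exact: fg.
  rewrite RintegralB //; last 2 first.
  - apply: (@borel_integrable (fun y => 2 * M * g y)) => y.
    by apply: cvgM; [exact: cvg_cst|exact: cg].
  - by apply: (@borel_integrable (fun=> M)) => y; exact: cvg_cst.
  rewrite RintegralZl //; last exact: borel_integrable.
  by rewrite Rintegral_probability_cst mulr1.
have -> : (fun n => pint (w n) (fun k => f (orbit k))) =
    (fun n => 2 * M * pint (w n) (fun k => g (orbit k)) - M * (w n).[1]).
  apply/funext => n; rewrite -pintZr -pint_cst -pintBr.
  by congr pint; apply/funext => k; rewrite fg.
exact.
Qed.

End UniqueErgodicity.

(** * Counting elements by number of prime factors *)

Section Factorizations.
Variables (G : monoidType) (S : arithSemigroup G).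
Implicit Types (g h p : G).

Definition factors g : seq G := s2val (cid2 (factorization S g)).

Lemma factors_prime g : {in factors g, forall p, prime_elts S p}.
Proof. by rewrite /factors; case: cid2. Qed.

Lemma factors_prod g : (\prod_(p <- factors g) p)%g = g.
Proof. by rewrite /factors; case: cid2 => s /= _ ->. Qed.

Lemma perm_factors (s : seq G) : {in s, forall p, prime_elts S p} ->
  perm_eq (factors (\prod_(p <- s) p)%g) s.
Proof.
move=> sP; apply: (@factorization_uniq _ S) => //; first exact: factors_prime.
exact: factors_prod.
Qed.

(** Commutativity is a field of [S] and not a structure carried by [G], hence the direct
    induction. *)
Lemma perm_prodg (s t : seq G) : perm_eq s t ->
  (\prod_(p <- s) p = \prod_(p <- t) p)%g.
Proof.
elim: s t => [|x s IH] t; first by rewrite perm_sym => /perm_nilP ->.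
move=> st; have : x \in t by rewrite -(perm_mem st) mem_head.
move: st => /[swap]; case/splitPr => t1 t2.
rewrite -[x :: t2]cat1s perm_sym perm_catCA perm_cons perm_sym => /IH st.
rewrite big_cons st !big_cat big_seq1 /= !mulgA; congr (_ * _)%g.
exact: (mulgC S).
Qed.

Lemma prodg_nseq p r : (\prod_(x <- nseq r p) x = p ^+ r)%g.
Proof.
elim: r => [|r IH]; first by rewrite big_nil expg0.
by rewrite big_cons IH expgS.
Qed.

Lemma perm_factorsM p r h : prime_elts S p ->
  perm_eq (factors (p ^+ r * h)%g) (nseq r p ++ factors h).
Proof.
move=> pP; rewrite -prodg_nseq -[in X in perm_eq X](factors_prod h) -big_cat.
apply: perm_factors => x; rewrite mem_cat => /orP[/nseqP[-> _] //|].
exact: factors_prime.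
Qed.

Lemma Omega_expM p r h : prime_elts S p ->
  Omega S (p ^+ r * h)%g = (r + Omega S h)%N.
Proof.
by move=> /(perm_factorsM r h)/perm_size; rewrite size_cat size_nseq.
Qed.

Lemma deg_exp p r : deg S (p ^+ r)%g = (r * deg S p)%N.
Proof.
elim: r => [|r IH]; first by rewrite expg0 deg1.
by rewrite expgS degM IH mulSn.
Qed.

Lemma deg_factors g : deg S g = (\sum_(p <- factors g) deg S p)%N.
Proof.
rewrite -{1}(factors_prod g); elim: (factors g) => [|p s IH].
  by rewrite !big_nil deg1.
by rewrite !big_cons degM IH.
Qed.

Lemma expM_inj p r : prime_elts S p -> injective (fun h => (p ^+ r * h)%g).
Proof.
move=> pP h h' hh'; rewrite -[h]factors_prod -[h']factors_prod.
apply: perm_prodg; rewrite -(perm_cat2l (nseq r p)).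
apply: perm_trans (perm_factorsM r h' pP); rewrite -hh' perm_sym.
exact: perm_factorsM.
Qed.

Lemma factors_dvd p r g : prime_elts S p ->
  reflect (exists h, g = (p ^+ r * h)%g) (r <= count_mem p (factors g))%N.
Proof.
move=> pP; apply: (iffP idP) => [rc|[h ->]]; last first.
  have /seq.permP/(_ (pred1 p)) -> := perm_factorsM r h pP.
  by rewrite count_cat count_nseq /= eqxx mul1n leq_addr.
exists (\prod_(x <- nseq (count_mem p (factors g) - r) p ++
                    seq.filter (predC1 p) (factors g)) x)%g.
rewrite -[LHS]factors_prod -prodg_nseq -big_cat catA -nseqD subnKC //.
apply: perm_prodg; have -> : nseq (count_mem p (factors g)) p =
    seq.filter (pred1 p) (factors g).
  by rewrite -size_filter; apply/esym/all_pred1P; exact: filter_all.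
by rewrite perm_sym perm_filterC.
Qed.

(** The additive form of [log = Lambda * 1]: the degree is the sum of [deg p] over the prime powers
    [p^r] dividing [g], that is, with [r] at most the multiplicity of [p]. *)
Lemma deg_factors_count g (P : seq G) (n : nat) : uniq P ->
  (forall p, prime_elts S p -> (deg S p <= n)%N -> p \in P) -> (deg S g <= n)%N ->
  (\sum_(p <- P) \sum_(1 <= r < n.+1 | (r <= count_mem p (factors g))%N) deg S p
   = deg S g)%N.
Proof.
move=> uP PP gn.
have cn p : (count_mem p (factors g) <= n)%N.
  apply: leq_trans gn; apply: leq_trans (count_size _ _) _.
  rewrite deg_factors -sum1_size !big_seq; apply: leq_sum => q /factors_prime.
  exact: deg_gt0.
transitivity (\sum_(p <- P) count_mem p (factors g) * deg S p)%N.
  apply: eq_bigr => p _.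
  rewrite -(big_nat_widen 1 (count_mem p (factors g)).+1 n.+1 xpredT) ?ltnS //.
  by rewrite sum_nat_const_nat subn1.
rewrite [RHS]deg_factors.
transitivity (\sum_(p <- P) \sum_(q <- factors g | q == p) deg S q)%N.
  apply: eq_bigr => p _; rewrite -sum1_count big_distrl /=.
  by apply: eq_bigr => q /eqP ->; rewrite mul1n.
rewrite (exchange_big_dep xpredT) //= big_seq [RHS]big_seq.
apply: eq_bigr => q qg; rewrite -big_filter.
have -> : [seq p <- P | q == p] = [:: q].
  rewrite (eq_filter (a2 := pred1 q)); last by move=> p; rewrite /= eq_sym.
  rewrite filter_pred1_uniq // PP //; first exact: factors_prime qg.
  apply: leq_trans gn; rewrite [leqRHS]deg_factors (perm_big _ (perm_to_rem qg)) /=.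
  by rewrite big_cons leq_addr.
by rewrite big_seq1.
Qed.

Lemma finite_deg (n : nat) : finite_set [set g | deg S g = n].
Proof. by apply: sub_finite_set (deg_finite S n) => g /= ->. Qed.

Definition elts (n : nat) : {fset G} := fset_set [set g | deg S g = n].

Lemma mem_elts n g : (g \in elts n) = (deg S g == n).
Proof.
rewrite in_fset_set; last exact: finite_deg.
by apply/idP/eqP => [/set_mem|] //; exact: mem_set.
Qed.

Definition primes_le (n : nat) : {fset G} :=
  fset_set [set p | prime_elts S p /\ (deg S p <= n)%N].

Lemma mem_primes_le n p :
  (p \in primes_le n) <-> prime_elts S p /\ (deg S p <= n)%N.
Proof.
rewrite in_fset_set; last by apply: sub_finite_set (deg_finite S n) => g [].
by split => [/set_mem|] //; exact: mem_set.
Qed.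

Variable R : realType.

Definition omega_poly (n : nat) : {poly R} := \sum_(g <- elts n) 'X^(Omega S g).

(* [sum_(p,r) deg(p) X^r] over the prime powers [p^r] of degree [m], the
   [Omega]-weighted version of [Lambda_bar]; [n] only truncates the sum and is
   irrelevant as soon as [m <= n]. *)
Definition Lambda_poly (n m : nat) : {poly R} :=
  \sum_(p <- primes_le n) \sum_(1 <= r < n.+1 | (r * deg S p == m)%N)
    'X^r *+ deg S p.

Lemma big_elts_dvd n p r : prime_elts S p ->
  \sum_(g <- elts n | (r <= count_mem p (factors g))%N) 'X^(Omega S g) =
  if (r * deg S p <= n)%N then 'X^r * omega_poly (n - r * deg S p) else 0.
Proof.
move=> pP; have [rn|nr] := leqP (r * deg S p)%N n; last first.
  rewrite big_seq_cond big1 // => g /andP[]; rewrite mem_elts => /eqP gn.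
  move=> /(factors_dvd r g pP)[h gE].
  by move: nr; rewrite -gn gE degM deg_exp leqNgt ltnS leq_addr.
rewrite -big_filter /omega_poly mulr_sumr.
have -> : \sum_(h <- elts (n - r * deg S p)) 'X^r * 'X^(Omega S h) =
  \sum_(g <- [seq (p ^+ r * h)%g | h <- elts (n - r * deg S p)])
    'X^(Omega S g) :> {poly R}.
  by rewrite big_map; apply: eq_bigr => h _; rewrite Omega_expM // exprD.
apply: perm_big; apply: uniq_perm.
- by rewrite filter_uniq // fset_uniq.
- by rewrite map_inj_uniq ?fset_uniq //; exact: expM_inj.
move=> g; rewrite mem_filter; apply/andP/mapP => [[/(factors_dvd r g pP)[h ->]]|].
  rewrite mem_elts degM deg_exp => /eqP hn; exists h => //.
  by rewrite mem_elts -hn addKn.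
move=> [h + ->]; rewrite !mem_elts degM deg_exp => /eqP ->.
by rewrite subnKC //; split => //; apply/(factors_dvd r _ pP); exists h.
Qed.

(** The logarithmic derivative of the Euler product of the [1 / (1 - X z^(deg p))]. Combinatorially,
    [n = deg g] is spread over the prime powers dividing [g], and [g = p^r h] contributes [X^r]
    times the monomial of [h]. *)
Lemma omega_poly_logderiv N n : (n <= N)%N ->
  omega_poly n *+ n = conv (Lambda_poly N) omega_poly n.
Proof.
move=> nN.
transitivity (\sum_(p <- primes_le N) \sum_(1 <= r < N.+1)
   \sum_(g <- elts n | (r <= count_mem p (factors g))%N)
      'X^(Omega S g) *+ deg S p : {poly R}).
  rewrite -sumrMnl.
  transitivity (\sum_(g <- elts n) \sum_(p <- primes_le N)
     \sum_(1 <= r < N.+1 | (r <= count_mem p (factors g))%N)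
      'X^(Omega S g) *+ deg S p : {poly R}).
    rewrite big_seq [RHS]big_seq; apply: eq_bigr => g; rewrite mem_elts => /eqP gn.
    under [RHS]eq_bigr do rewrite sumrMnr; rewrite sumrMnr.
    rewrite (@deg_factors_count g _ N) ?gn ?fset_uniq // => p pP pN.
    exact/mem_primes_le.
  rewrite exchange_big; apply: eq_bigr => p _ /=.
  by rewrite (exchange_big_dep xpredT).
rewrite /conv.
transitivity (\sum_(p <- primes_le N) \sum_(1 <= r < N.+1)
   \sum_(i < n.+1 | (r * deg S p)%N == i)
      'X^r *+ deg S p * omega_poly (n - i)).
  rewrite big_seq [RHS]big_seq; apply: eq_bigr => p /mem_primes_le[pP _].
  apply: eq_bigr => r _; rewrite sumrMnl big_elts_dvd //.
  case: leqP => [rn|nr].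
    rewrite (big_pred1 (Ordinal (rn : (r * deg S p < n.+1)%N))) /= ?mulrnAl //.
  rewrite big_pred0 ?mul0rn // => i; apply/eqP => ri.
  by move: nr; rewrite ri leqNgt ltn_ord.
under [RHS]eq_bigr => i _.
  rewrite mulr_suml; under eq_bigr do rewrite mulr_suml.
  over.
rewrite [RHS]exchange_big; apply: eq_bigr => p _ /=.
by rewrite [RHS](exchange_big_dep xpredT).
Qed.

End Factorizations.

(** * Prime powers of a given degree *)

Section PrimePowers.
Variables (G : monoidType) (S : arithSemigroup G).

Definition prime_powers (m : nat) : set (G * nat) :=
  [set pr | [/\ prime_elts S pr.1, (1 <= pr.2)%N & deg S (pr.1 ^+ pr.2)%g = m]].

(** An explicit list of the prime powers of degree [m <= N]: as [r >= 1] and [deg p >= 1], both are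
    at most [r * deg p = m]. *)
Let pp_seq (N m : nat) : seq (G * nat) :=
  [seq pr <- [seq (p, r) | p <- primes_le S N, r <- index_iota 1 N.+1]
     | (pr.2 * deg S pr.1 == m)%N].

Let mem_pp_seq N m pr : (m <= N)%N -> pr \in pp_seq N m <-> prime_powers m pr.
Proof.
case: pr => p r mN; rewrite mem_filter /prime_powers /= deg_exp; split.
  case/andP => /eqP rm /allpairsP[[p' r'] /= [pP]].
  rewrite mem_index_iota => /andP[r1 _] [pp' rr'].
  by move/mem_primes_le: pP => [pP _]; rewrite pp' rr'; split => //; rewrite -rr' -pp'.
move=> [pP r1 rm]; rewrite rm eqxx /=; apply/allpairsP; exists (p, r) => /=.
have p0 := deg_gt0 pP.
split => //; last by rewrite mem_index_iota r1 ltnS (leq_trans _ mN) // -rm leq_pmulr.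
by apply/mem_primes_le; split => //; rewrite (leq_trans _ mN) // -rm leq_pmull.
Qed.

Lemma finite_prime_powers m : finite_set (prime_powers m).
Proof.
apply: (@sub_finite_set _ _ [set` pp_seq m m]); last exact: finite_seq.
by move=> pr /(mem_pp_seq pr (leqnn m)).
Qed.

Lemma big_prime_powers (V : Type) (idx : V) (op : Monoid.com_law idx)
    (F : G * nat -> V) (N m : nat) : (m <= N)%N ->
  \big[op/idx]_(pr <- fset_set (prime_powers m)) F pr =
  \big[op/idx]_(p <- primes_le S N)
    \big[op/idx]_(1 <= r < N.+1 | (r * deg S p == m)%N) F (p, r).
Proof.
move=> mN; transitivity (\big[op/idx]_(pr <- pp_seq N m) F pr).
  apply: perm_big; apply: uniq_perm; first exact: fset_uniq.
    rewrite filter_uniq // allpairs_uniq ?fset_uniq ?iota_uniq //.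
    by move=> [p r] [p' r'].
  move=> pr; rewrite in_fset_set; last exact: finite_prime_powers.
  by apply/idP/idP => [/set_mem/(mem_pp_seq pr mN)|/(mem_pp_seq pr mN)/mem_set].
rewrite big_filter big_mkcond big_allpairs; apply: eq_bigr => p _.
by rewrite [RHS]big_mkcond.
Qed.

Lemma Lambda_barE m :
  Lambda_bar S m = (\sum_(pr <- fset_set (prime_powers m)) deg S pr.1)%N.
Proof. by rewrite /Lambda_bar fsbig_finite //; exact: finite_prime_powers. Qed.

(** A prime has at most one power of degree [m]. If its exponent is at least 2, then
    [deg p <= m / 2], and its weight already occurs in [Lambda_bar (deg p)] with exponent 1. *)
Lemma Lambda_bar_square m :
  (\sum_(pr <- fset_set (prime_powers m) | pr.2 != 1%N) deg S pr.1 <=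
   \sum_(d < m./2.+1) Lambda_bar S d)%N.
Proof.
rewrite big_mkcond (@big_prime_powers _ _ _ _ m) //=.
have -> : (\sum_(d < m./2.+1) Lambda_bar S d =
    \sum_(p <- primes_le S m) \sum_(d < m./2.+1)
      \sum_(1 <= r < m.+1 | (r * deg S p == d)%N) deg S p)%N.
  rewrite exchange_big; apply: eq_bigr => d _; rewrite Lambda_barE.
  by rewrite (@big_prime_powers _ _ _ _ m) //; have := ltn_ord d; lia.
rewrite big_seq [leqRHS]big_seq; apply: leq_sum => p /mem_primes_le[pP pm].
have p0 := deg_gt0 pP; rewrite -big_mkcondr.
have [m2|m2] := leqP (2 * deg S p) m.
  apply: (@leq_trans (deg S p)).
    apply: (@leq_trans (\sum_(1 <= r < m.+1 | r == m %/ deg S p) deg S p)%N).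
      rewrite [leqLHS]big_mkcond [leqRHS]big_mkcond; apply: leq_sum => r _.
      by case: ifP => // /andP[/eqP <- _]; rewrite mulnK // eqxx.
    by rewrite big_nat1_eq; case: ifP.
  have dk : (deg S p < m./2.+1)%N by rewrite ltnS; lia.
  rewrite (bigD1 (Ordinal dk)) //= (leq_trans _ (leq_addr _ _)) //.
  rewrite big_ltn_cond ?mul1n ?eqxx ?leq_addr // ltnS; lia.
rewrite big_nat_cond big1 // => r /andP[/andP[r1 _] /andP[/eqP rm rn1]].
by move: m2 rm; nia.
Qed.

Variable R : realType.

Definition Lambda_lead (m : nat) : nat :=
  (\sum_(pr <- fset_set (prime_powers m) | pr.2 == 1%N) deg S pr.1)%N.
Definition Lambda_rest (m : nat) : nat :=
  (\sum_(pr <- fset_set (prime_powers m) | pr.2 != 1%N) deg S pr.1)%N.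

Lemma Lambda_barD m : Lambda_bar S m = (Lambda_lead m + Lambda_rest m)%N.
Proof. by rewrite Lambda_barE (bigID (fun pr => pr.2 == 1%N)). Qed.

Lemma Lambda_polyE N m : (m <= N)%N -> Lambda_poly S R N m =
  \sum_(pr <- fset_set (prime_powers m)) 'X^(pr.2) *+ deg S pr.1.
Proof. by move=> mN; rewrite (@big_prime_powers _ _ _ _ _ _ mN). Qed.

(** The primes themselves give a multiple of [X]. Proper powers are paid for twice: once for their
    own monomials, once for completing the primes to [Lambda_bar]. *)
Lemma norm1_Lambda_poly N m (c : R) : (m <= N)%N -> 0 <= c ->
  norm1 (c *: Lambda_poly S R N m - 'X) <=
  `|c * (Lambda_bar S m)%:R - 1| + 2 * (c * (Lambda_rest m)%:R).
Proof.
move=> mN c0; rewrite Lambda_polyE // (bigID (fun pr => pr.2 == 1%N)) /=.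
have -> : \sum_(pr <- fset_set (prime_powers m) | pr.2 == 1%N)
    'X^(pr.2) *+ deg S pr.1 = (Lambda_lead m)%:R *: 'X :> {poly R}.
  rewrite scaler_nat /Lambda_lead -sumrMnr; apply: eq_bigr => pr /eqP ->.
  by rewrite expr1.
set E := \sum_(_ <- _ | _) _.
have EM : norm1 E <= (Lambda_rest m)%:R.
  rewrite (le_trans (norm1_sum _ _ _)) // /Lambda_rest natr_sum.
  apply: ler_sum => pr _; rewrite -scaler_nat norm1Z normr_nat.
  rewrite -[leRHS]mulr1 ler_wpM2l //.
  elim: (pr.2) => [|k IH]; first by rewrite norm11.
  by rewrite exprS norm1X.
have -> : c *: ((Lambda_lead m)%:R *: 'X + E) - 'X =
    (c * (Lambda_lead m)%:R - 1) *: 'X + c *: E.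
  by rewrite scalerDr scalerA scalerBl scale1r addrAC.
rewrite (le_trans (norm1D _ _)) // !norm1Z norm1_X mulr1 (ger0_norm c0).
have h1 := ler_wpM2l c0 EM.
have : `|c * (Lambda_lead m)%:R - 1| <=
    `|c * (Lambda_bar S m)%:R - 1| + c * (Lambda_rest m)%:R.
  have -> : c * (Lambda_lead m)%:R - 1 =
      (c * (Lambda_bar S m)%:R - 1) - c * (Lambda_rest m)%:R.
    by rewrite Lambda_barD natrD; ring.
  by rewrite (le_trans (ler_normB _ _)) // lerD2l ger0_norm // mulr_ge0.
lra.
Qed.

End PrimePowers.

(** * Growth estimates and the law of [Omega] *)

Section Asymptotics.
Variable R : realType.

Lemma summable_geometric (a : nat -> R) (C r : R) : 0 <= r < 1 ->
  (forall m, 0 <= a m) -> (\forall m \near \oo, a m <= C * r ^+ m) ->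
  exists B, forall N, \sum_(m < N) a m <= B.
Proof.
move=> /andP[r0 r1] a0 [M _ HM].
have C0 : 0 <= `|C| by [].
exists (\sum_(m < M) a m + `|C| / (1 - r)) => N.
have geo : \sum_(m < N) `|C| * r ^+ m <= `|C| / (1 - r).
  rewrite -mulr_sumr ler_wpM2l // -[leRHS]mul1r ler_pdivlMr ?subr_gt0 // mulrC.
  by rewrite -[1 - r]opprB mulNr -subrX1 opprB gerBl exprn_ge0.
apply: (@le_trans _ _ (\sum_(m < M + N) a m)).
  by apply: ler_sum_ord => //; exact: leq_addl.
rewrite big_split_ord /= lerD2l (le_trans _ geo) //.
apply: ler_sum => m _; rewrite (le_trans (HM (M + m)%N (leq_addr _ _))) //.
apply: (@le_trans _ _ (`|C| * r ^+ (M + m))).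
  by rewrite ler_wpM2r ?exprn_ge0 // ler_norm.
by rewrite ler_wpM2l // ler_wiXn2l ?leq_addl // ltW.
Qed.

Variables (G : monoidType) (S : arithSemigroup G).
Variables (c q eta : R).

Lemma powR_ratio_lt1 theta : 1 < q -> theta < 1 -> 0 <= q `^ theta / q < 1.
Proof.
move=> q1 t1; have q0 : 0 < q by rewrite (lt_trans ltr01).
rewrite divr_ge0 ?powR_ge0 ?(ltW q0) //= ltr_pdivrMr // mul1r.
rewrite -[ltRHS]powRr1 ?(ltW q0) // /powR gt_eqF // ltr_expR mul1r.
by rewrite gtr_pMl // ln_gt0.
Qed.

Lemma bigO_ratio (u : nat -> R) (a theta : R) : 1 < q ->
  (fun n : nat => u n - a * q ^+ n) =O_\oo (fun n : nat => q `^ (theta * n%:R)) ->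
  exists k, \forall n \near \oo,
    `|(q ^+ n)^-1 * u n - a| <= k * (q `^ theta / q) ^+ n.
Proof.
move=> q1; have q0 : 0 < q by rewrite (lt_trans ltr01).
move=> /eqO_exP[k k0 Hk]; exists k; apply: filterS Hk => n Hn.
have qn : 0 < q ^+ n by rewrite exprn_gt0.
rewrite -(ler_pM2l qn) -{1}[q ^+ n](gtr0_norm qn) -normrM mulrBr mulrA mulfV ?gt_eqF //.
rewrite mul1r [q ^+ n * a]mulrC (le_trans Hn) // ger0_norm ?powR_ge0 //.
rewrite powRrM powR_mulrn ?powR_ge0 // expr_div_n mulrCA ler_wpM2l ?(ltW k0) //.
by rewrite mulrCA mulfV ?gt_eqF // mulr1.
Qed.

Lemma count_deg_cvg : axiom_Asharp S c q eta ->
  (q ^+ n)^-1 * (count_deg S n)%:R @[n --> \oo] --> c.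
Proof.
move=> [c0 q1 /andP[e0 e1]] /(bigO_ratio q1)[k Hk].
have /andP[t0 t1] := powR_ratio_lt1 q1 e1.
apply/subr_cvg0/norm_cvg0P.
apply: (squeeze_cvgr (f := cst 0) (h := fun n => k * (q `^ eta / q) ^+ n)).
- by apply: filterS Hk => n ->; rewrite normr_ge0.
- exact: cvg_cst.
- have := cvgM (cvg_cst k) (cvg_expr (z := q `^ eta / q) _).
  by rewrite mulr0; apply; rewrite ger0_norm.
Qed.

(** After division by [q^m], the prime number theorem leaves an error of order [q^((theta - 1) m)],
    and the proper prime powers one of order [q^(- m / 2)]; both are geometric. *)
Lemma Lambda_poly_summable : 1 < q -> classical_PNT S q eta ->
  exists C, forall N,
    \sum_(m < N) norm1 ((q ^+ m.+1)^-1 *: Lambda_poly S R m.+1 m.+1 - 'X) <= C.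
Proof.
move=> q1 [theta /andP[_ t1]] HL.
have q0 : 0 < q by rewrite (lt_trans ltr01).
have [k Hk] : exists k, \forall n \near \oo,
    `|(q ^+ n)^-1 * (Lambda_bar S n)%:R - 1| <= k * (q `^ theta / q) ^+ n.
  by apply: bigO_ratio => //; under eq_fun do rewrite mul1r.
have [B HB] := summable_geometric (powR_ratio_lt1 q1 t1) (fun m => normr_ge0 _) Hk.
pose a m := `|(q ^+ m)^-1 * (Lambda_bar S m)%:R - 1|.
have aB m : a m <= B.
  by rewrite (le_trans _ (HB m.+1)) // big_ord_recr /= lerDr sumr_ge0.
have B0 : 0 <= B by apply: le_trans (aB 0%N); exact: normr_ge0.
have LB m : (Lambda_bar S m)%:R <= (1 + B) * q ^+ m.
  rewrite -ler_pdivrMr ?exprn_gt0 // mulrC.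
  by have := aB m; rewrite /a ler_norml => /andP[_]; lra.
pose s := (Num.sqrt q)^-1.
have s1 : 1 < Num.sqrt q by rewrite -sqrtr1 ltr_sqrt.
have s01 : 0 <= s < 1.
  by rewrite invr_ge0 sqrtr_ge0 /= invf_lt1 // (lt_trans ltr01).
(* [1 + B] bounds [Lambda_bar d / q^d], and [q / (q - 1)] is the loss in summing [q^d] up to
   [d = m / 2]. *)
pose D := (1 + B) * (q / (q - 1)).
have qq : 0 < q - 1 by rewrite subr_gt0.
have D0 : 0 <= D by rewrite mulr_ge0 ?divr_ge0 ?(ltW q0) ?(ltW qq) //; lra.
have rest m : (q ^+ m)^-1 * (Lambda_rest S m)%:R <= D * s ^+ m.
  have qs : q ^+ m * s ^+ m = Num.sqrt q ^+ m.
    rewrite -exprMn; congr (_ ^+ m); rewrite -{1}[q]sqr_sqrtr ?(ltW q0) //.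
    by rewrite /s expr2 mulfK // gt_eqF // (lt_trans ltr01).
  have qhalf : q ^+ m./2 <= Num.sqrt q ^+ m.
    rewrite -{1}[q]sqr_sqrtr ?(ltW q0) // -exprM ler_weXn2l ?(ltW s1) //; lia.
  rewrite ler_pdivrMl ?exprn_gt0 // mulrCA qs.
  apply: le_trans (ler_wpM2l D0 qhalf).
  have := Lambda_bar_square S m; rewrite -(ler_nat R) [leRHS]natr_sum => /le_trans; apply.
  apply: (@le_trans _ _ (\sum_(d < m./2.+1) (1 + B) * q ^+ d)).
    by apply: ler_sum => d _; exact: LB.
  rewrite -mulr_sumr /D -!mulrA ler_wpM2l //; first lra.
  rewrite mulrCA [_^-1 * _]mulrC -exprS ler_pdivlMr // mulrC -subrX1.
  by rewrite gerBl.
have [B' HB'] : exists B', forall N, \sum_(m < N) D * s ^+ m <= B'.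
  apply: (@summable_geometric (fun m => D * s ^+ m) D s s01) => [m|].
    by rewrite mulr_ge0 // exprn_ge0 //; case/andP: s01.
  by near=> m.
exists (B + 2 * B') => N.
apply: (@le_trans _ _ (\sum_(m < N) (a m.+1 + 2 * (D * s ^+ m.+1)))).
  apply: ler_sum => m _.
  have qm : 0 <= (q ^+ m.+1)^-1 by rewrite invr_ge0 exprn_ge0 ?(ltW q0).
  apply: le_trans (norm1_Lambda_poly S (leqnn m.+1) qm) _.
  by rewrite lerD2l ler_wpM2l.
rewrite big_split /= -mulr_sumr lerD //.
  apply: le_trans (HB N.+1); rewrite big_ord_recl /= lerDr //.
rewrite ler_wpM2l //; apply: le_trans (HB' N.+1); rewrite big_ord_recl /=.
by rewrite lerDr expr0 mulr1.
Unshelve. all: by end_near. Qed.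

Definition Omega_law (n : nat) : {poly R} :=
  (#|` fset_set (elts_le S n)|%:R)^-1 *:
    \sum_(g <- fset_set (elts_le S n)) 'X^(Omega S g).

Lemma pint_Xn k f : pint ('X^k : {poly R}) f = f k.
Proof.
rewrite /pint size_polyXn big_ord_recr /= coefXn eqxx mul1r big1 ?add0r // => i _.
by rewrite coefXn ltn_eqF ?mul0r.
Qed.

Lemma pint_Omega_law n f : pint (Omega_law n) f =
  (#|` fset_set (elts_le S n)|%:R)^-1 *
    \sum_(g <- fset_set (elts_le S n)) f (Omega S g).
Proof.
by rewrite pintZ pint_sum; congr (_ * _); apply: eq_bigr => g _; rewrite pint_Xn.
Qed.

Lemma omega_poly_horner1 n : (omega_poly S R n).[1] = (count_deg S n)%:R.
Proof.
rewrite /omega_poly horner_sum (eq_bigr (fun=> 1)) => [|g _].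
  by rewrite big_const_seq count_predT iter_addr_0 /count_deg cardfE.
by rewrite hornerXn expr1n.
Qed.

Lemma omega_poly_ge0 n i : 0 <= (omega_poly S R n)`_i.
Proof. by rewrite coef_sum sumr_ge0 // => g _; rewrite coefXn. Qed.

Lemma sum_omega_poly n : \sum_(g <- fset_set (elts_le S n)) 'X^(Omega S g) =
  \sum_(m < n.+1) omega_poly S R m.
Proof.
have fin : finite_set (elts_le S n) by exact: deg_finite.
transitivity (\sum_(m < n.+1)
   \sum_(g <- fset_set (elts_le S n) | deg S g == m) 'X^(Omega S g) : {poly R}).
  rewrite (exchange_big_dep xpredT) //= big_seq [RHS]big_seq.
  apply: eq_bigr => g; rewrite in_fset_set // => /set_mem gn.
  by rewrite (big_pred1 (Ordinal (gn : (deg S g < n.+1)%N))).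
apply: eq_bigr => m _; rewrite -big_filter; apply: perm_big; apply: uniq_perm.
- by rewrite filter_uniq // fset_uniq.
- exact: fset_uniq.
move=> g; rewrite mem_filter mem_elts andbC in_fset_set //.
apply: andb_idl => /eqP gm; apply: mem_set; rewrite /elts_le /= gm.
by rewrite -ltnS.
Qed.

(** [P] rescales each degree by its own power of [q]; relative to [q^n], the degree [n - m] keeps
    the weight [q^-m]. *)
Lemma Omega_law_avg n : 0 < q ->
  let P n := (q ^+ n)^-1 *: omega_poly S R n in
  let V := \sum_(m < n.+1) q^-1 ^+ m *: P (n - m)%N in
  Omega_law n = V.[1]^-1 *: V.
Proof.
move=> q0 P V.
have VE : V = (q ^+ n)^-1 *: \sum_(g <- fset_set (elts_le S n)) 'X^(Omega S g).
  rewrite sum_omega_poly scaler_sumr /V (reindex_inj rev_ord_inj) /=.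
  apply: eq_bigr => m _; rewrite /P scalerA subSS subKn -1?ltnS //.
  congr (_ *: _); by rewrite exprVn -invfM -exprD subnK -1?ltnS.
have VN : (\sum_(g <- fset_set (elts_le S n)) 'X^(Omega S g) : {poly R}).[1] =
    #|` fset_set (elts_le S n)|%:R.
  rewrite horner_sum (eq_bigr (fun=> 1)) => [|g _].
    by rewrite big_const_seq count_predT iter_addr_0 cardfE.
  by rewrite hornerXn expr1n.
rewrite VE hornerZ VN scalerA invfM invrK mulrAC mulfV ?mul1r //.
by rewrite gt_eqF // exprn_gt0.
Qed.

(** The prime number theorem supplies the summable error in the logarithmic derivative, and the
    axiom supplies the positive limit [c] of the values at 1. *)
Theorem Omega_law_cyclep : axiom_Asharp S c q eta -> classical_PNT S q eta ->
  norm1 (Omega_law n - cyclep R n) @[n --> \oo] --> (0 : R).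
Proof.
move=> HA HP; have [c0 q1 _ _] := HA.
have q0 : 0 < q by rewrite (lt_trans ltr01).
pose P n := (q ^+ n)^-1 *: omega_poly S R n.
pose lam m := (q ^+ m)^-1 *: Lambda_poly S R m m.
have P1 n : (P n).[1] = (q ^+ n)^-1 * (count_deg S n)%:R.
  by rewrite hornerZ omega_poly_horner1.
have Pc : (P n).[1] @[n --> \oo] --> c.
  by under eq_fun do rewrite P1; exact: count_deg_cvg.
have normP n : norm1 (P n) = (P n).[1].
  apply: norm1_nneg => i; rewrite coefZ mulr_ge0 ?omega_poly_ge0 //.
  by rewrite invr_ge0 exprn_ge0 // ltW.
have lamE N m : (m <= N)%N -> Lambda_poly S R N m = Lambda_poly S R m m.
  by move=> mN; rewrite !Lambda_polyE.
have lam0 : lam 0%N = 0.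
  rewrite /lam /Lambda_poly big1 ?scaler0 // => p _.
  by rewrite big_geq.
have P0 : P 0%N = 1.
  rewrite /P expr0 invr1 scale1r /omega_poly.
  have f1 : factors S 1%g = [::].
    by apply/perm_nilP; rewrite -[1%g](big_nil 1%g mul xpredT id); exact: perm_factors.
  have -> : elts S 0 = [fset 1%g]%fset.
    apply/fsetP => g; rewrite mem_elts in_fset1; apply/eqP/eqP => [g0|->]; last exact: deg1.
    rewrite -[g](factors_prod S); case E : (factors S g) => [|p s]; first by rewrite big_nil.
    have pg : p \in factors S g by rewrite E mem_head.
    by have := deg_gt0 (factors_prime pg); have := deg_factors S g;
      rewrite g0 E big_cons; lia.
  by rewrite big_seq_fset1 /Omega -/(factors S 1%g) f1.
have recP n : P n *+ n = conv lam P n.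
  rewrite scalerMnr (omega_poly_logderiv _ _ (leqnn n)) /conv scaler_sumr.
  apply: eq_bigr => i _; have iN : (i <= n)%N by rewrite -ltnS.
  by rewrite lamE // -scalerAl -scalerAr scalerA -invfM -exprD subnKC.
have [C HC] := Lambda_poly_summable q1 HP.
have PQ := cyclep_approx lam0 P0 recP HC Pc.
have [B HB] : exists B, forall n, norm1 (P n) <= B.
  have [M [_ HM]] := cvg_seq_bounded (cvgP _ Pc).
  exists (M + 1) => n; rewrite normP (le_trans (ler_norm _)) //.
  by apply: HM => //; rewrite ltrDl.
have t01 : 0 <= q^-1 < 1 by rewrite invr_ge0 ltW //= invf_lt1.
pose V n := \sum_(m < n.+1) q^-1 ^+ m *: P (n - m)%N.
have -> : (fun n => norm1 (Omega_law n - cyclep R n)) =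
    (fun n => norm1 ((V n).[1]^-1 *: V n - cyclep R n)).
  by apply/funext => n; rewrite Omega_law_avg.
exact: cyclep_approx_avg c0 t01 HB PQ.
Qed.

End Asymptotics.

(** * Assembly *)

Section WeightedShift.
Variable R : realType.
Implicit Types (p : {poly R}) (h f : nat -> R).

Definition reweight p h : {poly R} := \poly_(i < size p) (p`_i * h i).

Lemma pint_reweight p h f : pint (reweight p h) f = pint p (fun k => h k * f k).
Proof. by rewrite pint_poly; apply: eq_bigr => i _; rewrite mulrA. Qed.

Lemma reweight_ge0 p h : (forall i, 0 <= p`_i) -> (forall k, 0 <= h k) ->
  forall i, 0 <= (reweight p h)`_i.
Proof. by move=> p0 h0 i; rewrite coef_poly; case: ifP => // _; rewrite mulr_ge0. Qed.

(** A discrete Leibniz rule: shifting [h p] shifts [p], at a cost weighted by [B], and otherwise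
    sees only the increments of [h]. *)
Lemma norm1_shift_reweight p h B d : (forall k, `|h k| <= B) ->
  (forall k, `|h k.+1 - h k| <= d) ->
  norm1 (('X - 1) * reweight p h) <= norm1 (('X - 1) * p) * B + norm1 p * d.
Proof.
move=> hB hd; apply: norm1_le => f f1.
have B0 : 0 <= B by apply: le_trans (hB 0%N).
have d0 : 0 <= d by apply: le_trans (hd 0%N).
have -> : pint (('X - 1) * reweight p h) f =
    pint (('X - 1) * p) (fun k => h k * f k) -
    pint p (fun k => (h k.+1 - h k) * f k.+1).
  rewrite !mulrBl !mul1r !pintB !pintX !pint_reweight.
  by rewrite -!pintBr; congr pint; apply/funext => k; ring.
rewrite (le_trans (ler_norm _)) // (le_trans (ler_normB _ _)) // lerD //.
  apply: pint_le => k; rewrite normrM -[leRHS]mulr1.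
  by apply: ler_pM.
by apply: pint_le => k; rewrite normrM -[leRHS]mulr1; apply: ler_pM.
Qed.

End WeightedShift.

Section RealCase.
Context (R : realType) (G : monoidType) (S : arithSemigroup G).
Variables (c q eta : R).
Hypothesis HA : axiom_Asharp S c q eta.
Hypothesis HP : classical_PNT S q eta.
Context (X : pmetricType R) (mu : probability (borel X) R) (T : X -> X).
Hypothesis Hue : uniquely_ergodic mu T.
Local Notation law := (Omega_law R S).
Local Notation leb := (@lebesgue_measure R).

Lemma Omega_law_ge0 n i : 0 <= (law n)`_i.
Proof.
rewrite coefZ mulr_ge0 ?invr_ge0 // coef_sum sumr_ge0 // => g _.
by rewrite coefXn.
Qed.

Lemma Omega_law_horner1 n : (law n).[1] = 1.
Proof.
have N0 : #|` fset_set (elts_le S n)|%:R != 0 :> R.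
  rewrite pnatr_eq0 -lt0n cardfs_gt0; apply/fset0Pn; exists 1%g.
  by rewrite in_fset_set ?inE /elts_le /= ?deg1 //; exact: deg_finite.
rewrite -pint1 pint_Omega_law big_const_seq count_predT iter_addr_0.
exact: (mulVf N0).
Qed.

Lemma norm1_Omega_law n : norm1 (law n) = 1.
Proof. by rewrite norm1_nneg ?Omega_law_horner1 //; exact: Omega_law_ge0. Qed.

Lemma Omega_law_shift : norm1 (('X - 1) * law n) @[n --> \oo] --> (0 : R).
Proof.
have D0 := Omega_law_cyclep HA HP.
apply: (squeeze_cvgr (f := cst 0) (h := fun n =>
  2 * norm1 (law n - cyclep R n) + norm1 (('X - 1) * cyclep R n))).
- near=> n; rewrite norm1_ge0 /=.
  have -> : ('X - 1) * law n =
    ('X - 1) * (law n - cyclep R n) + ('X - 1) * cyclep R n by ring.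
  rewrite (le_trans (norm1D _ _)) // lerD2r (le_trans (norm1M _ _)) //.
  by rewrite ler_wpM2r ?norm1_ge0 ?norm1_X1.
- exact: cvg_cst.
- have := cvgD (cvgM (cvg_cst (2 : R)) D0) (@cyclep_shift0 R).
  rewrite mulr0 addr0; exact.
Unshelve. all: by end_near. Qed.

Lemma Omega_law_orbit (x : X) (f : X -> R) : continuous f ->
  pint (law n) (fun k => f (iter k T x)) @[n --> \oo] --> \int[mu]_y f y.
Proof.
move=> cf; apply: (pint_orbit_cvg Hue Omega_law_ge0 _ Omega_law_shift x cf).
by rewrite (_ : (fun n => _) = cst 1); [exact: cvg_cst|apply/funext => n; exact: Omega_law_horner1].
Qed.

(** The law reweighted by [F + M + 1] is an admissible weight for [pint_orbit_cvg]; subtracting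
    [M + 1] times the unweighted average recovers [F]. *)
Lemma Omega_law_orbit_clt (x : X) (f : X -> R) (F : R -> R) (K : R) :
  continuous f -> 0 < K -> continuous F -> (forall t, K <= `|t| -> F t = 0) ->
  pint (law n) (fun k => F ((k%:R - ln n%:R) / Num.sqrt (ln n%:R)) *
     f (iter k T x)) @[n --> \oo] -->
  (Num.sqrt (2 * pi))^-1 * \int[leb]_t (F t * gauss_weight t) * \int[mu]_y f y.
Proof.
move=> cf K0 cF F0; set A := _ * \int[leb]_t _.
have [M M0 FM] := csupp_bounded cF F0.
pose h n k := F ((k%:R - ln n%:R) / Num.sqrt (ln n%:R)).
have hM n k : `|h n k| <= M by exact: FM.
have D0 := Omega_law_cyclep HA HP.
have hA : pint (law n) (h n) @[n --> \oo] --> A.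
  have e0 : pint (law n - cyclep R n) (h n) @[n --> \oo] --> (0 : R).
    apply/norm_cvg0P; apply: (squeeze_cvgr (f := cst 0)
      (h := fun n => norm1 (law n - cyclep R n) * M)).
    - by near=> n; rewrite normr_ge0 /=; apply: pint_le.
    - exact: cvg_cst.
    - have := cvgM D0 (cvg_cst M); rewrite mul0r; exact.
  have -> : (fun n => pint (law n) (h n)) =
      (fun n => pint (law n - cyclep R n) (h n) + pint (cyclep R n) (h n)).
    by apply/funext => n; rewrite -pintD subrK.
  have := cvgD e0 (cyclep_clt K0 cF F0); rewrite add0r; exact.
have AM : - M <= A.
  apply: (cvgr_to_ge hA); near=> n.
  have := pint_le (law n) (hM n); rewrite norm1_Omega_law mul1r.
  by rewrite ler_norml => /andP[].
(* The limiting mass of the reweighted law; [A >= - M] makes it at least 1, so it can be divided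
   out. *)
pose C := A + M + 1.
have C0 : 0 < C by rewrite /C; lra.
pose H n k := h n k + (M + 1).
have H0 n k : 0 <= H n k by have := hM n k; rewrite /H ler_norml => /andP[]; lra.
have HB n k : `|H n k| <= 2 * M + 1.
  have := hM n k; rewrite ler_norml => /andP[h1 h2].
  by rewrite ger0_norm // /H; lra.
pose w n := C^-1 *: reweight (law n) (H n).
have wE n f' : pint (w n) f' =
    C^-1 * (pint (law n) (fun k => h n k * f' k) + (M + 1) * pint (law n) f').
  rewrite pintZ pint_reweight; congr (_ * _).
  rewrite -pintZr -pintDr; congr pint.
  by apply/funext => k; rewrite /H mulrDl.
have w0 n i : 0 <= (w n)`_i.
  rewrite coefZ mulr_ge0 ?invr_ge0 ?(ltW C0) //.
  by apply: reweight_ge0 => //; exact: Omega_law_ge0.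
have w1 : (w n).[1] @[n --> \oo] --> (1 : R).
  have -> : (fun n => (w n).[1]) =
      (fun n => C^-1 * (pint (law n) (h n) + (M + 1))).
    apply/funext => n; rewrite -pint1 wE pint1 Omega_law_horner1 mulr1.
    by congr (_ * (pint _ _ + _)); apply/funext => k; rewrite mulr1.
  have CE : C^-1 * (A + (M + 1)) = 1 by rewrite addrA mulVf // gt_eqF.
  have := cvgM (cvg_cst C^-1) (cvgD hA (cvg_cst (M + 1))); rewrite CE; exact.
have wS : norm1 (('X - 1) * w n) @[n --> \oo] --> (0 : R).
  apply/cvgr0Pnorm_le => e e0.
  have Ce : 0 < C * e / 2 by rewrite divr_gt0 // mulr_gt0.
  have [d d0 Hd] := csupp_unif cF F0 Ce.
  have Hs : \forall n \near \oo, norm1 (('X - 1) * law n) * (2 * M + 1) <= C * e / 2.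
    have S0 : norm1 (('X - 1) * law n) * (2 * M + 1) @[n --> \oo] --> (0 : R).
      have := cvgM Omega_law_shift (cvg_cst (2 * M + 1)); rewrite mul0r; exact.
    move/cvgr0Pnorm_le : S0 => /(_ _ Ce); apply: filterS => n; apply: le_trans.
    exact: ler_norm.
  have Hln : \forall n \near \oo, (d^-1 + 1) ^+ 2 <= ln n%:R :> R.
    exact: near_inftyS (near_ln _).
  near=> n.
  have s1 : d^-1 < Num.sqrt (ln n%:R).
    rewrite (@lt_le_trans _ _ (d^-1 + 1)) ?ltrDl //.
    rewrite -[leLHS]ger0_norm ?addr_ge0 ?invr_ge0 ?(ltW d0) // -sqrtr_sqr.
    by rewrite ler_wsqrtr //; near: n.
  have s0 : 0 < Num.sqrt (ln n%:R) :> R by apply: lt_trans s1; rewrite invr_gt0.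
  (* Consecutive arguments of [F] differ by [1 / sqrt(ln n) < d]. *)
  have Hdiff k : `|H n k.+1 - H n k| <= C * e / 2.
    rewrite /H opprD addrACA subrr addr0; apply: Hd.
    rewrite -mulrBl opprB addrA subrK -natr1 addrAC subrr add0r mul1r.
    by rewrite gtr0_norm ?invr_gt0 // invf_plt ?posrE.
  rewrite ger0_norm ?norm1_ge0 // /w -scalerAr norm1Z gtr0_norm ?invr_gt0 //.
  rewrite ler_pdivrMl //; apply: le_trans (norm1_shift_reweight _ (HB n) Hdiff) _.
  rewrite norm1_Omega_law mul1r [leRHS](splitr (C * e)) lerD2r.
  by near: n.
have E1 := pint_orbit_cvg Hue w0 w1 wS x cf.
have E2 := Omega_law_orbit x cf.
have -> : (fun n => pint (law n) (fun k => h n k * f (iter k T x))) =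
    (fun n => C * pint (w n) (fun k => f (iter k T x)) -
      (M + 1) * pint (law n) (fun k => f (iter k T x))).
  by apply/funext => n; rewrite wE mulrA mulfV ?gt_eqF // mul1r addrK.
have -> : A = C - (M + 1) by rewrite /C; ring.
rewrite mulrBl.
have := cvgB (cvgM (cvg_cst C) E1) (cvgM (cvg_cst (M + 1)) E2); exact.
Unshelve. all: by end_near. Qed.

End RealCase.

(** * Reduction to real and imaginary parts *)

Section ComplexValues.
Variable R : realType.
Local Open Scope complex_scope.
Local Notation C := R[i]^o.

Lemma normc_bound (z : R[i]) (e : R) :
  `|complex.Re z| + `|complex.Im z| < e -> `|z| < e%:C.
Proof.
move=> He; rewrite normc_def ltcR; apply: le_lt_trans He.
rewrite -[leRHS]ger0_norm ?addr_ge0 // -sqrtr_sqr ler_wsqrtr //.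
rewrite sqrrD !real_normK ?num_real // -addrA lerD2l lerDr mulrn_wge0 // mulr_ge0.
Qed.

Lemma ReIm_le_normc (z : R[i]) (e : R) :
  `|z| < e%:C -> `|complex.Re z| < e /\ `|complex.Im z| < e.
Proof.
rewrite normc_def ltcR => He; split; apply: le_lt_trans He;
  by rewrite -sqrtr_sqr ler_wsqrtr // ?lerDl ?lerDr sqr_ge0.
Qed.

Lemma cvg_Complex (u v : nat -> R) (a b : R) :
  u @ \oo --> a -> v @ \oo --> b ->
  (fun n => Complex (u n) (v n) : C) @ \oo --> (Complex a b : C).
Proof.
move=> ua vb; apply/cvgrPdist_lt => -[e e'] /=.
rewrite ltcE /= => /andP[/eqP -> e0]; have e2 : 0 < e / 2 by rewrite divr_gt0.
have Ha := (cvgrPdist_lt _ _).1 ua _ e2; have Hb := (cvgrPdist_lt _ _).1 vb _ e2.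
near=> n; apply: normc_bound => /=.
have h1 : `|a - u n| < e / 2 by near: n; exact: Ha.
have h2 : `|b - v n| < e / 2 by near: n; exact: Hb.
lra.
Unshelve. all: by end_near. Qed.

Lemma continuous_ReIm (T : topologicalType) (f : T -> C) : continuous f ->
  continuous (fun t => complex.Re (f t)) /\ continuous (fun t => complex.Im (f t)).
Proof.
move=> cf; split => t; apply/cvgrPdist_lt => e e0;
  have e0C : 0 < e%:C :> C by rewrite ltcR.
- apply: filterS ((cvgrPdist_lt _ _).1 (cf t) _ e0C) => y Hy.
  by have [+ _] := ReIm_le_normc Hy; case: (f t) (f y) => [a b] [a' b'].
- apply: filterS ((cvgrPdist_lt _ _).1 (cf t) _ e0C) => y Hy.
  by have [_ +] := ReIm_le_normc Hy; case: (f t) (f y) => [a b] [a' b'].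
Qed.

Lemma sum_Complex (I : Type) (s : seq I) (a b : I -> R) :
  \sum_(i <- s) Complex (a i) (b i) =
  Complex (\sum_(i <- s) a i) (\sum_(i <- s) b i) :> R[i].
Proof. by elim: s => [|i s IH]; rewrite ?big_nil // !big_cons IH. Qed.

Lemma scale_Complex (N : nat) (a b : R) :
  (N%:R : R[i])^-1 * Complex a b = Complex (N%:R^-1 * a) (N%:R^-1 * b).
Proof.
have -> : (N%:R : R[i])^-1 = (N%:R^-1 : R)%:C by rewrite fmorphV rmorph_nat.
by rewrite /GRing.mul /=; congr Complex; rewrite mul0r ?subr0 ?addr0.
Qed.

Lemma avg_Omega_law (G : monoidType) (S : arithSemigroup G) (n : nat) (z : nat -> R[i]) :
  (#|` fset_set (elts_le S n)|%:R)^-1 * \sum_(g \in elts_le S n) z (Omega S g) =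
  Complex (pint (Omega_law R S n) (fun k => complex.Re (z k)))
          (pint (Omega_law R S n) (fun k => complex.Im (z k))).
Proof.
rewrite fsbig_finite /=; last exact: deg_finite.
rewrite (eq_bigr (fun g => Complex (complex.Re (z (Omega S g)))
  (complex.Im (z (Omega S g))))); last by move=> g _; case: (z _).
by rewrite sum_Complex scale_Complex !pint_Omega_law.
Qed.

Lemma compact_support_bound (F : R -> C) : continuous_compact_support F ->
  exists2 K, 0 < K & forall t, K <= `|t| -> F t = 0.
Proof.
move=> [_ /compact_bounded/pinfty_ex_gt0[M M0 HM]]; exists (M + 1); first lra.
move=> t Mt; apply: contrapT => Ft.
have : `|t| <= M by apply: HM; apply: subset_closure; exact/eqP.
by move: Mt => /= ? ?; lra.
Qed.

End ComplexValues.

Local Open Scope complex_scope.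

Theorem theorem1p3 (R : realType) (G : monoidType) (S : arithSemigroup G)
    (c q eta : R) (HA : axiom_Asharp S c q eta) (HP : classical_PNT S q eta)
    (X : pmetricType R) (mu : probability (borel X) R) (T : X -> X)
    (Hue : uniquely_ergodic mu T) :
  (forall F : R -> R[i]^o, continuous_compact_support F ->
   forall (x : X) (f : X -> R[i]^o), continuous f ->
    (fun n : nat => (#|` fset_set (elts_le S n)|%:R)^-1 *
       \sum_(g \in elts_le S n)
         (F (((Omega S g)%:R - ln n%:R) / Num.sqrt (ln n%:R)) *
          f (iter (Omega S g) T x)) : R[i]^o) @ \oo -->
    (((Num.sqrt (2 * pi))^-1)%:C *
      Cintegral lebesgue_measure (fun t : R => F t * (expR (- t ^+ 2 / 2))%:C) *
     Cintegral mu f : R[i]^o))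
  /\
  (forall (x : X) (f : X -> R[i]^o), continuous f ->
    (fun n : nat => (#|` fset_set (elts_le S n)|%:R)^-1 *
       \sum_(g \in elts_le S n) f (iter (Omega S g) T x) : R[i]^o) @ \oo -->
    (Cintegral mu f : R[i]^o)).
Proof.
split=> [F FC x f cf|x f cf]; last first.
  have [cf1 cf2] := continuous_ReIm cf.
  rewrite (_ : (fun n => _) = (fun n =>
    Complex (pint (Omega_law R S n) (fun k => complex.Re (f (iter k T x))))
            (pint (Omega_law R S n) (fun k => complex.Im (f (iter k T x)))) : R[i]^o)).
    apply: cvg_Complex; first exact: (Omega_law_orbit HA HP Hue x cf1).
    exact: (Omega_law_orbit HA HP Hue x cf2).
  by apply/funext => n; exact: (avg_Omega_law S n (fun k => f (iter k T x))).
have [cf1 cf2] := continuous_ReIm cf.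
have [cF1 cF2] := continuous_ReIm FC.1.
have [K K0 F0] := compact_support_bound FC.
pose F1 t := complex.Re (F t); pose F2 t := complex.Im (F t).
have F10 t : K <= `|t| -> F1 t = 0 by rewrite /F1 => /F0 ->.
have F20 t : K <= `|t| -> F2 t = 0 by rewrite /F2 => /F0 ->.
pose W n k : R := (k%:R - ln n%:R) / Num.sqrt (ln n%:R).
pose f1 k := complex.Re (f (iter k T x)); pose f2 k := complex.Im (f (iter k T x)).
pose P n := pint (Omega_law R S n).
(* The product of [F] and [f] expands into four real products, each covered by
   [Omega_law_orbit_clt]. *)
have z_avg n : (#|` fset_set (elts_le S n)|%:R)^-1 * \sum_(g \in elts_le S n)
      (F (W n (Omega S g)) * f (iter (Omega S g) T x)) =
    Complex (P n (fun k => F1 (W n k) * f1 k) - P n (fun k => F2 (W n k) * f2 k))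
      (P n (fun k => F1 (W n k) * f2 k) + P n (fun k => F2 (W n k) * f1 k)).
  rewrite (avg_Omega_law S n (fun k => F (W n k) * f (iter k T x))).
  rewrite -pintBr -pintDr; congr (Complex (pint _ _) (pint _ _)); apply/funext => k;
    by rewrite /F1 /F2 /f1 /f2; case: (F _) (f _) => [a b] [a' b'].
rewrite (_ : (fun n => _) = (fun n => Complex
   (P n (fun k => F1 (W n k) * f1 k) - P n (fun k => F2 (W n k) * f2 k))
   (P n (fun k => F1 (W n k) * f2 k) + P n (fun k => F2 (W n k) * f1 k)) : R[i]^o));
  last by apply/funext => n; exact: z_avg.
pose I1 := (Num.sqrt (2 * pi))^-1 * \int[lebesgue_measure]_t (F1 t * gauss_weight t).
pose I2 := (Num.sqrt (2 * pi))^-1 * \int[lebesgue_measure]_t (F2 t * gauss_weight t).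
pose m1 := \int[mu]_y complex.Re (f y); pose m2 := \int[mu]_y complex.Im (f y).
have -> : ((Num.sqrt (2 * pi))^-1)%:C *
     Cintegral lebesgue_measure (fun t : R => F t * (expR (- t ^+ 2 / 2))%:C) *
     Cintegral mu f = Complex (I1 * m1 - I2 * m2) (I1 * m2 + I2 * m1).
  have -> : Cintegral lebesgue_measure (fun t : R => F t * (expR (- t ^+ 2 / 2))%:C) =
     Complex (\int[lebesgue_measure]_t (F1 t * gauss_weight t))
             (\int[lebesgue_measure]_t (F2 t * gauss_weight t)).
    rewrite /Cintegral; congr Complex; apply: eq_Rintegral => t _;
      rewrite /F1 /F2 /gauss_weight; case: (F t) => a b /=; ring.
  rewrite /Cintegral -/m1 -/m2; set a := (Num.sqrt _)^-1.
  have -> (u v : R) : a%:C * Complex u v = Complex (a * u) (a * v).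
    by rewrite /GRing.mul /=; congr Complex; rewrite mul0r ?subr0 ?addr0.
  by [].
by apply: cvg_Complex; [apply: cvgB|apply: cvgD];
  exact: (Omega_law_orbit_clt HA HP Hue _ _ K0).
Qed.
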